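(* Work in the Gaussian white noise model described in the context, and let condition $C1(\kappa,L)$ be satisfied with some known constants $\kappa>0$ and $L<\infty$. Consider the asymptotic set-up in which both $d=d_n$ and $d^*=d^*_n$ tend to infinity as $n\to\infty$. Assume that $d$ grows at a sub-exponential rate in $n$, that is, $\log\log d=o(\log n)$. If $$\limsup_{n\to\infty}\frac{d^*}{\log n}<\frac{2}{l_\gamma(z_\gamma)}\qquad\text{with }\gamma=L/\kappa,$$ then consistent estimation of $J$ is possible and can be achieved, for instance, by the estimator $\widehat J_n=\widehat J_n(\mathbf m,\boldsymbol\lambda)$ (with suitably chosen tuning parameters $(\mathbf m,\boldsymbol\lambda)$ depending only on $n,d,d^*,\kappa,L$).
   Context: $e$ is Euler's number; $1\le d^*\le d$. For each $n$ the regression function $f=f_n$ on $[0,1]^{d_n}$ satisfies $C1(\kappa,L)$ with sparsity pattern $J=J_n$ ($\kappa,L$ do not depend on $n$); consistent estimation means that $\mathbf P(\widehat J_n\neq J_n)\to0$ as $n\to\infty$ for every such sequence $f_n$. Fourier basis: for $\mathbf k\in\mathbb Z^d$, $\varphi_{\mathbf 0}\equiv1$, $\varphi_{\mathbf k}(\mathbf x)=\sqrt2\cos(2\pi\mathbf k\cdot\mathbf x)$ if $\mathbf k\in(\mathbb Z^d)_+$ and $\varphi_{\mathbf k}(\mathbf x)=\sqrt2\sin(2\pi\mathbf k\cdot\mathbf x)$ if $-\mathbf k\in(\mathbb Z^d)_+$, where $(\mathbb Z^d)_+$ is the set of $\mathbf k\in\mathbb Z^d\setminus\{0\}$ whose first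 nonzero coordinate is positive. For $f\in L^2([0,1]^d)$, $\theta_{\mathbf k}[f]=\int_{[0,1]^d}f\varphi_{\mathbf k}$. Condition $C1(\kappa,L)$: $\sum_{\mathbf k\in\mathbb Z^d}k_j^2\theta_{\mathbf k}[f]^2\le L$ for all $j\in\{1,\dots,d\}$; and for some $J\subset\{1,\dots,d\}$ with $\operatorname{Card}(J)\le d^*$ (the sparsity pattern) there is a function $\bar f:\mathbb R^{\operatorname{Card}(J)}\to\mathbb R$ with $f(\mathbf x)=\bar f(\mathbf x_J)$ for all $\mathbf x$ ($\mathbf x_J$ being the subvector of coordinates with index in $J$), and $\sum_{\mathbf k:k_j\neq0}\theta_{\mathbf k}[f]^2\ge\kappa$ for all $j\in J$. Gaussian white noise model: one observes a Gaussian process $\{\mathbf Y(\phi):\phi\in L^2([0,1]^d)\}$ with $\mathbf E[\mathbf Y(\phi)]=\int f\phi$ and $\operatorname{Cov}(\mathbf Y(\phi),\mathbf Y(\phi'))=\frac1n\int\phi\phi'$. Put $y_{\mathbf k}=\mathbf Y(\varphi_{\mathbf k})$; thus $y_{\mathbf k}=\theta_{\mathbf k}[f]+n^{-1/2}\xi_{\mathbf k}$ with $\xi_{\mathbf k}$ i.i.d. $N(0,1)$. Estimator: let $P^d_\ell$ be the set of subsets of $\{1,\dots,d\}$ with exactly $\ell$ elements. For $m>0$, $I\subset\{1,\dots,d\}$ and $j\in\{1,\dots,d\}$, let $S^j_{m,I}=\{\mathbf k\in\mathbb Z^d:\|\mathbf k\|_2\le m,\ \{j\}\subset\operatorname{supp}(\mathbf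 k)\subset I\}$, where $\operatorname{supp}(\mathbf k)$ is the set of indices of nonzero coordinates, and $\widehat Q^j_{m,I}=\sum_{\mathbf k\in S^j_{m,I}}(y_{\mathbf k}^2-\frac1n)$ (equal to $0$ if the sum is empty). For $\mathbf m=(m_1,\dots,m_{d^*})$ and $\boldsymbol\lambda=(\lambda_1,\dots,\lambda_{d^*})$ with positive entries, $$\widehat J_n(\mathbf m,\boldsymbol\lambda)=\Bigl\{j\in\{1,\dots,d\}:\max_{\ell\le d^*}\lambda_\ell^{-1}\max_{I\in P^d_\ell}\widehat Q^j_{m_\ell,I}\ge1\Bigr\}.$$ The tuning recommended in the paper is, for constants $\tau>0$, $A>1$: $m_\ell=(\ell L(1+\tau)/\kappa)^{1/2}$ and $\lambda_\ell=n^{-1}\bigl(2\sqrt{A\,N(\ell,m_\ell^2/\ell)\,d^*\log(2ed/d^* )}+2Ad^*\log(2ed/d^* )\bigr)$, where $N(\ell,\gamma)=\operatorname{Card}\{\mathbf k\in\mathbb Z^\ell:\|\mathbf k\|_2^2\le\gamma\ell,\ k_1\neq0\}$. The Jacobi $\theta$-function is $h(z)=\sum_{r\in\mathbb Z}z^{r^2}$ for $|z|<1$; $l_\gamma(z)=\log h(z)-\gamma\log z$ for $z\in(0,1)$; and $z_\gamma$ is the unique solution in $(0,1)$ of $l_\gamma'(z)=0$. *)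

(* Defs.v *)
From HB Require Import structures.
From mathcomp Require Import all_boot all_order all_algebra.
From mathcomp Require Import all_classical all_reals all_analysis.

Set Implicit Arguments.
Unset Strict Implicit.
Unset Printing Implicit Defensive.

Import Order.TTheory GRing.Theory Num.Def Num.Theory.
Import numFieldTopology.Exports numFieldNormedType.Exports.

Local Open Scope classical_set_scope.
Local Open Scope ring_scope.

(** Lebesgue measure on [0,1]^d, as a probability on d-tuples of reals.
    [uniform_prob] on [0,1] has density 1 on [0,1] and 0 elsewhere, i.e. it is
    the Lebesgue measure restricted to [0,1]; the d-fold product is built by
    transporting the binary product measure along the cons map. *)
Section cube_measure.
Context {R : realType}.

Definition cube_cons d (x : measurableTypeR R * d.-tuple R) : d.+1.-tuple R :=
  [tuple of x.1 :: x.2].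

Lemma measurable_cube_cons d : measurable_fun 
  [set: measurableTypeR R * d.-tuple R] (@cube_cons d).
Proof. exact: measurable_cons measurable_fst measurable_snd. Qed.

HB.instance Definition _ d :=
  isMeasurableFun.Build _ _ _ _ (@cube_cons d) (@measurable_cube_cons d).

Definition unit_interval_prob : probability (measurableTypeR R) R := uniform_prob (@ltr01 R).

Fixpoint cube_prob (d : nat) : probability (d.-tuple R) R :=
  match d with
  | 0 => \d_([tuple] : 0.-tuple R)
  | d'.+1 => distribution (unit_interval_prob \x cube_prob d')%E (@cube_cons d')
  end.

End cube_measure.

Section model.
Context {R : realType}.

Definition unit_cube d : set (d.-tuple R) :=
  [set x | forall i, 0 <= tnth x i <= 1].

(** Functions on the cube are represented by functions on R^d; only their values
    on the cube matter. *)
Definition L2_cube d (f : d.-tuple R -> R) : Prop :=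
  f \in Lfun (cube_prob d) 2%:E.

Definition inner_cube d (f g : d.-tuple R -> R) : R :=
  \int[cube_prob d]_x (f x * g x).

Definition freq d := {ffun 'I_d -> int}.

Definition first_pos d (k : freq d) : bool :=
  [exists i : 'I_d, (0 < k i) && [forall j : 'I_d, (j < i)%N ==> (k j == 0)]].

Definition dotp d (k : freq d) (x : d.-tuple R) : R :=
  \sum_(i < d) (k i)%:~R * tnth x i.

(** For k <> 0, exactly one of k and -k satisfies [first_pos]. *)
Definition fourier d (k : freq d) (x : d.-tuple R) : R :=
  if k == [ffun=> 0] then 1
  else if first_pos k then Num.sqrt 2 * cos (2 * pi * dotp k x)
  else Num.sqrt 2 * sin (2 * pi * dotp k x).

Definition theta d (f : d.-tuple R -> R) (k : freq d) : R :=
  inner_cube f (fourier k).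

Definition subvec d (J : {set 'I_d}) (x : d.-tuple R) : #|J|.-tuple R :=
  [tuple tnth x (enum_val i) | i < #|J|].

(** Condition C1(kappa, L) at sparsity level s, with sparsity pattern J. *)
Definition C1 (kappa L : R) (s d : nat) (f : d.-tuple R -> R)
    (J : {set 'I_d}) : Prop :=
  [/\ forall j : 'I_d,
        (\esum_(k in [set: freq d]) ((k j)%:~R ^+ 2 * theta f k ^+ 2)%:E
           <= L%:E)%E,
      (#|J| <= s)%N,
      exists fbar : #|J|.-tuple R -> R,
        forall x, unit_cube x -> f x = fbar (subvec J x) &
      forall j, j \in J ->
        (kappa%:E <=
           \esum_(k in [set k : freq d | (k j != 0)%R]) (theta f k ^+ 2)%:E)%E].

(** [X] has a (possibly degenerate) normal law; [normal_prob m s] is only the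
    intended normal law for [s != 0], s being the standard deviation. *)
Definition is_gaussian disp (Omega : measurableType disp)
    (P : probability Omega R) (X : Omega -> R) : Prop :=
  exists m s : R, forall A : set R, measurable A ->
    P (X @^-1` A) = if s == 0 then \d_m A else normal_prob m s A.

(** Gaussian white noise model with sample size n: [Y] is a Gaussian process on
    L^2([0,1]^d) (every finite linear combination is Gaussian) with the
    prescribed mean and covariance. The values of [Y] outside L^2 are
    irrelevant. *)
Definition white_noise (n d : nat) (f : d.-tuple R -> R)
    disp (Omega : measurableType disp) (P : probability Omega R)
    (Y : (d.-tuple R -> R) -> {RV P >-> R}) : Prop :=
  [/\ forall (r : nat) (a : 'I_r -> R) (phi : 'I_r -> d.-tuple R -> R),
        (forall i, L2_cube (phi i)) ->
        is_gaussian P (fun w => \sum_(i < r) a i * Y (phi i) w),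
      forall phi, L2_cube phi -> 'E_P[Y phi]%E = (inner_cube f phi)%:E &
      forall phi phi', L2_cube phi -> L2_cube phi' ->
        covariance P (Y phi) (Y phi') = (n%:R^-1 * inner_cube phi phi')%:E].

(** The index set S^j_{m,I}. *)
Definition S_freq d (j : 'I_d) (m : R) (I : {set 'I_d}) : set (freq d) :=
  [set k | Num.sqrt (\sum_(i < d) (k i)%:~R ^+ 2) <= m /\
           ([set j] \subset [set i | k i != 0]%SET)%SET /\
           ([set i | k i != 0]%SET \subset I)].

(** In the next two definitions [y] is the observed realization
    phi |-> Y(phi). *)
Definition Qhat (n d : nat) (y : (d.-tuple R -> R) -> R)
    (j : 'I_d) (m : R) (I : {set 'I_d}) : R :=
  \sum_(k \in S_freq j m I) (y (fourier k) ^+ 2 - n%:R^-1).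

(** The maxima are taken in the extended reals, with -oo for an empty maximum;
    the vectors m and lam are indexed from 1 to s. *)
Definition Jhat (n d s : nat) (m lam : nat -> R)
    (y : (d.-tuple R -> R) -> R) : {set 'I_d} :=
  [set j : 'I_d |
    (1 <= \big[maxe/-oo]_(1 <= l < s.+1)
            ((lam l)^-1%:E *
             \big[maxe/-oo]_(I : {set 'I_d} | #|I| == l)
               (Qhat n y j (m l) I)%:E))%E]%SET.

(** Consistency of a sequence of estimators, each a function of the observed
    realization: the probability of error tends to 0 along every sequence of
    regression functions satisfying C1(kappa, L). *)
Definition consistent (kappa L : R) (d s : nat -> nat)
    (Jn : forall n, (((d n).-tuple R -> R) -> R) -> {set 'I_(d n)}) : Prop :=
  forall (disp : nat -> measure_display)
    (Omega : forall n, measurableType (disp n))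
    (P : forall n, probability (Omega n) R)
    (f : forall n, (d n).-tuple R -> R)
    (J : forall n, {set 'I_(d n)})
    (Y : forall n, ((d n).-tuple R -> R) -> {RV (P n) >-> R}),
  (forall n, (0 < n)%N ->
     [/\ L2_cube (f n), C1 kappa L (s n) (f n) (J n) &
         white_noise n (f n) (Y n)]) ->
  P n [set w | Jn n (fun phi => Y n phi w) <> J n] @[n --> \oo] --> 0%E.

(** Jacobi theta function h(z) = sum over r in Z of z^(r^2), as an unconditional
    sum of nonnegative terms; only used for z >= 0. *)
Definition jacobi_theta (z : R) : R :=
  fine (\esum_(r in [set: int]) (z ^+ (absz r ^ 2)%N)%:E)%E.

Definition l_jacobi (gamma z : R) : R :=
  ln (jacobi_theta z) - gamma * ln z.

(** The zero of l_gamma' in (0,1), which exists and is unique for gamma > 0;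
    the value is 0 by default when there is none. *)
Definition z_jacobi (gamma : R) : R :=
  xget 0 [set z : R | 0 < z < 1 /\ is_derive z 1 (l_jacobi gamma) 0].

End model.

(* Main.v *)
Require Import Defs.
From HB Require Import structures.
From mathcomp Require Import all_boot all_order all_algebra.
From mathcomp Require Import all_classical all_reals all_analysis.
From mathcomp Require Import measurable_realfun ring lra zify.

Set Implicit Arguments.
Unset Strict Implicit.
Unset Printing Implicit Defensive.

Import Order.TTheory GRing.Theory Num.Def Num.Theory.
Import numFieldTopology.Exports numFieldNormedType.Exports.

Local Open Scope classical_set_scope.
Local Open Scope ring_scope.

(** If [f] depends only on the coordinates in [J], its Fourier coefficients vanish at every [k]
    whose support is not contained in [J]. Truncating at [|k|^2 <= m_l^2 ~ l L / kappa] therefore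
    keeps at least [2 lam ~ 1 / ln n] of the energy [kappa] carried by a relevant coordinate,
    while for every [0 < z < 1] the number [N] of frequencies is at most
    [z^(- m_l^2) h(z)^l = exp (l * l_gamma(z) + O(1))], which at [z = z_gamma] is
    [O(n^(2 - eta))] by the assumption on [d*]. The noise [n^-1 * sum (xi_k^2 - 1)] has size
    [sqrt N / n], hence is negligible with respect to [lam], with exponential tails that survive a
    union bound over the at most [d^(d* + 1)] pairs [(j, I)].

    No independence of the [xi_k] is needed: [exp (a |x|^2)] is a Gaussian average of
    exponentials of linear forms, so the law of linear combinations determines the exponential
    moments of the quadratic form. *)

(** * Fourier coefficients on the cube *)

(** The two kinds of error are paid for differently. A false positive must survive a union over
    about [d^(s + 1)] pairs, where [ln d] is only known to be [n^(o(1))], so it needs an exponential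
    tail; a missed coordinate costs a mere factor [s], since testing the single set [I = J] is
    enough, and a polynomially small probability suffices. This fits what Gaussian averaging can
    deliver: the slope [sqrt (2 a)] of the linear forms is real only for [a >= 0], so exponential
    moments come on the upper side alone, and the lower tail is drawn from the vanishing mean
    together with the upper moment. The exponents balance as follows. With [N] of order at most
    [n^(2 - eta)], the choice [a = n^(eta/2 - 1) / 4] keeps the second-order term [4 a^2 N] bounded,
    while the gain [a n lam] is of order [n^(eta/2) / ln n]. Since [ln d <= n^(eta/4)] eventually,
    the union cost [(s + 1) ln d] is of lower order. *)

Section fourier.
Context {R : realType}.
Local Notation mu := lebesgue_measure.

Lemma sinD_intpi (c : R) (k : int) : sin (2 * pi * k%:~R + c) = sin c.
Proof.
case: k => n; rewrite ?NegzE ?mulrN ?mulrNz /= addrC [2 * pi]mulr_natl mulr_natr.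
  exact: (periodicn (@sinD2pi R)).
by rewrite -(periodicn (@sinD2pi R) n.+1) subrK.
Qed.

Lemma cos_bound (t : R) : `|cos t| <= 1.
Proof. by rewrite ler_norml cos_geN1 cos_le1. Qed.

Lemma integral_uniform_cos (a c : R) (k : int) : k != 0 -> a = 2 * pi * k%:~R ->
  (\int[unit_interval_prob]_x (cos (a * x + c))%:E = 0)%E.
Proof.
move=> k0 aE.
have a0 : a != 0 by rewrite aE mulf_neq0 ?intr_eq0// mulf_neq0// ?gt_eqF ?pi_gt0.
have mf : measurable_fun [set: R] (fun x : R => cos (a * x + c)).
  apply: measurableT_comp => //.
    by apply: continuous_measurable_fun; exact: continuous_cos.
  by apply: measurable_funD => //; exact: measurable_funM.
have int_f : (@unit_interval_prob R).-integrable setT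
    (fun x : measurableTypeR R => (cos (a * x + c))%:E).
  apply: measurable_bounded_integrable => //.
    by rewrite (le_lt_trans (probability_le1 _ _))// ltry.
  by exists 1; split => // M M1 x _ /=; exact: le_trans (cos_bound _) (ltW M1).
(* [integral_uniform] asks for a nonnegative integrand, whence the shift by 1; the sine part of the
   primitive takes equal values at 0 and 1. *)
suff : (\int[unit_interval_prob]_x (1 + cos (a * x + c))%:E = 1)%E.
  under eq_integral do rewrite EFinD.
  rewrite integralD_EFin//=; last first.
    by apply: finite_measure_integrable_cst.
  have U1 : (@unit_interval_prob R [set: measurableTypeR R] = 1)%E.
    exact: (@probability_setT _ _ _ (@unit_interval_prob R)).
  rewrite integral_cst// [X in (1 * X)%E]U1 mule1.
  case: (\int[_]_x _)%E => //= r [] /eqP.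
  by rewrite -subr_eq0 addrAC subrr add0r => /eqP ->.
rewrite integral_uniform; last 2 first.
- by apply/measurable_EFinP; exact: measurable_funD.
- by move=> x; rewrite lee_fin -lerBlDl sub0r cos_geN1.
rewrite subr0 invr1 mul1e.
pose F (x : R) := x + a^-1 * sin (a * x + c).
have dF (x : R) : is_derive x 1 F (1 + cos (a * x + c)).
  rewrite /F; apply: is_derive_eq.
  rewrite /GRing.scale /= !mulr1 addr0 mulrCA mulrC.
  by rewrite mulVf// mul1r.
have cF : continuous F.
  by move=> x; apply/differentiable_continuous/derivable1_diffP; exact: ex_derive.
rewrite (@continuous_FTC2 _ _ F)//.
- rewrite /F -EFinB mulr1 mulr0 add0r add0r aE sinD_intpi.
  by congr EFin; rewrite -aE addrK.
- apply: continuous_subspaceT => x; apply: cvgD; first exact: cvg_cst.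
  apply: continuous_comp; last exact: continuous_cos.
  by apply: cvgD; [apply: cvgM; [exact: cvg_cst|exact: cvg_id]|exact: cvg_cst].
- split; first by move=> x _; exact: ex_derive.
  + by apply: cvg_at_right_filter; exact: cF.
  + by apply: cvg_at_left_filter; exact: cF.
- by move=> x _; rewrite derive1E derive_val.
Qed.

Lemma integral_cube_probS d (f : d.+1.-tuple R -> \bar R) :
  (cube_prob d.+1).-integrable setT f ->
  (unit_interval_prob \x cube_prob d)%E.-integrable setT (f \o @cube_cons R d) /\
  (\int[cube_prob d.+1]_x f x =
   \int[unit_interval_prob \x cube_prob d]_z f (cube_cons z))%E.
Proof.
move=> fint.
have mf : measurable_fun setT f by exact: measurable_int fint.
have cint : (unit_interval_prob \x cube_prob d)%E.-integrable setT (f \o @cube_cons R d).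
  apply/integrableP; split; first exact: measurableT_comp.
  move/integrableP : fint => [_]; rewrite /= ge0_integral_pushforward//=.
  by apply: measurableT_comp.
split => //; rewrite /= integral_pushforward//.
Qed.

Lemma cube_prob_unit_cube d : measurable (@unit_cube R d) /\ cube_prob d (@unit_cube R d) = 1%E.
Proof.
have mC n : measurable (@unit_cube R n).
  rewrite (_ : unit_cube (d:=n) = \bigcap_(i in [set: 'I_n])
      ((fun x : n.-tuple R => tnth x i) @^-1` `[0, 1]%classic)); last first.
    by apply/seteqP; split => x /= h i; move: (h i); rewrite /= in_itv/= => // /(_ I).
  apply: fin_bigcap_measurable => // i _.
  by rewrite -[X in measurable X]setTI; apply: measurable_tnth.
split => //; elim: d => [|d IH].
  by rewrite /= /dirac indicE mem_set// => -[].
rewrite /= /distribution /pushforward.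
rewrite (_ : _ @^-1` _ = `[0, 1]%classic `*` @unit_cube R d); last first.
  apply/seteqP; split => -[u x] /=.
    move=> h; split; first by have := h ord0; rewrite /cube_cons (tnth_nth 0) /= in_itv.
    by move=> i; have := h (lift ord0 i); rewrite /cube_cons !(tnth_nth 0).
  rewrite in_itv /= => -[u01 h] i.
  case: (unliftP ord0 i) => [j|] ->; last by rewrite /cube_cons (tnth_nth 0).
  by have := h j; rewrite /cube_cons !(tnth_nth 0).
rewrite product_measure1E//; last exact: mC.
rewrite [X in (_ * X)%E]IH mule1.
by rewrite [LHS](integral_uniform_pdf1 (@ltr01 R)).
Qed.

Lemma probability_bounded_integrable d (T : measurableType d) (P : probability T R)
    (h : T -> R) (M : R) :
  measurable_fun setT h -> (forall x, `|h x| <= M) -> P.-integrable setT (EFin \o h).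
Proof.
move=> mh hM; apply: measurable_bounded_integrable => //.
  by rewrite (le_lt_trans (probability_le1 _ _))// ltry.
by exists M; split => [|N MN x _ /=]; [exact: num_real|exact: le_trans (hM x) (ltW MN)].
Qed.

Lemma dotp_cons d (k : freq d.+1) (u : R) (x : d.-tuple R) :
  dotp k (cube_cons (u, x)) =
  (k ord0)%:~R * u + dotp [ffun i => k (lift ord0 i)] x.
Proof.
rewrite /dotp big_ord_recl /cube_cons (tnth_nth 0)/=; congr (_ + _).
by apply: eq_bigr => i _; rewrite ffunE !(tnth_nth 0).
Qed.

Lemma measurable_dotp d (k : freq d) : measurable_fun setT (@dotp R d k).
Proof.
apply: measurable_sum => i; apply: measurable_funM => //.
exact: measurable_tnth.
Qed.

Lemma measurable_cosD (c : R) d (T : measurableType d) (h : T -> R) :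
  measurable_fun setT h -> measurable_fun setT (fun x => cos (2 * pi * h x + c)).
Proof.
move=> mh; apply: measurableT_comp.
  by apply: continuous_measurable_fun; exact: continuous_cos.
by apply: measurable_funD => //; exact: measurable_funM.
Qed.

(** Condition [C1] factors [f] only on the cube, whereas [cube_prob d] lives on all [d]-tuples; uses
    of the factorization therefore go through almost-everywhere statements. *)
Lemma ae_unit_cube d : {ae cube_prob d, forall x, @unit_cube R d x}.
Proof.
have [mC C1] := cube_prob_unit_cube d.
exists (~` unit_cube (d:=d)); split => //; first exact: measurableC.
by rewrite probability_setC// C1 subee.
Qed.

Lemma ae_unit_interval : {ae @unit_interval_prob R, forall u, 0 <= u <= 1}.
Proof.
have m01 : measurable (`[0, 1]%classic : set (measurableTypeR R)) by exact: measurable_itv.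
exists (~` (`[0, 1]%classic : set (measurableTypeR R))); split.
- exact: measurableC.
- rewrite probability_setC// [X in (_ - X)%E](_ : _ = 1%E) ?subee//.
  by rewrite [LHS](integral_uniform_pdf1 (@ltr01 R)).
- by move=> u /=; rewrite in_itv.
Qed.

Lemma measurable_cons2 d (x : d.-tuple R) :
  measurable_fun setT (fun u : measurableTypeR R => cube_cons (u, x)).
Proof. exact: (measurableT_comp (@measurable_cube_cons R d) (measurable_pair2 x)). Qed.

(* The integral over the [i]-th coordinate vanishes, whatever the other ones are. *)
Lemma integral_cube_cos d (i : 'I_d) (k : freq d) (g : d.-tuple R -> R) (c : R) :
  k i != 0 -> (cube_prob d).-integrable setT (EFin \o g) ->
  (forall x y, unit_cube x -> unit_cube y ->
     (forall j, j != i -> tnth x j = tnth y j) -> g x = g y) ->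
  (\int[cube_prob d]_x (g x * cos (2 * pi * dotp k x + c))%:E = 0)%E.
Proof.
elim: d i k g c => [[]//|d IH] i k g c ki gint ginv.
have mg : measurable_fun setT g by apply/measurable_EFinP; exact: measurable_int gint.
have gcint : (cube_prob d.+1).-integrable setT
    (fun x => (g x * cos (2 * pi * dotp k x + c))%:E).
  apply: (le_integrable measurableT _ _ gint) => /=.
    by apply/measurable_EFinP; apply: measurable_funM => //; apply: measurable_cosD;
      exact: measurable_dotp.
  by move=> x _; rewrite lee_fin normrM ler_piMr// cos_bound.
have [hint ->] := integral_cube_probS gcint.
have [gint' _] := integral_cube_probS gint.
(* If [i] is the first coordinate, it is integrated innermost, with [g] frozen at first coordinate
   0. Otherwise the first coordinate is integrated outermost and the induction hypothesis applies to
   almost every slice, those on which [g] is integrable. *)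
case: (unliftP ord0 i) => [i'|] iE; last first.
  rewrite -integral21_prod_meas1//.
  rewrite (ae_eq_integral (cst 0%E)) ?integral0//; first exact: (measurable_fubini_G hint).
  apply: filterS (ae_unit_cube d) => x x01 _ /=; rewrite /fubini_G.
  have z01 (u : R) : 0 <= u <= 1 -> unit_cube (cube_cons (u, x)).
    move=> u01 j; case: (unliftP ord0 j) => [l|] ->; rewrite (tnth_nth 0)//=.
    by have := x01 l; rewrite (tnth_nth 0).
  have mcos : measurable_fun setT (fun u : measurableTypeR R =>
      (cos (2 * pi * dotp k (cube_cons (u, x)) + c))).
    by apply: measurable_cosD; exact: (measurableT_comp (measurable_dotp k) (measurable_cons2 x)).
  rewrite (ae_eq_integral (fun u : measurableTypeR R => (g (cube_cons (0, x)))%:E *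
      (cos (2 * pi * dotp k (cube_cons (u, x)) + c))%:E)%E)//.
  + rewrite integralZl//; last first.
      by apply: (@probability_bounded_integrable _ _ _ _ 1) => // u; exact: cos_bound.
    under eq_integral do rewrite dotp_cons mulrDr mulrA -addrA.
    by rewrite (integral_uniform_cos _ (k := k i)) ?mule0// iE.
  + apply/measurable_EFinP; apply: measurable_funM => //.
    exact: (measurableT_comp mg (measurable_cons2 x)).
  + by apply/measurable_EFinP; apply: measurable_funM.
  + apply: (@filterS _ _ (ae_filter_ringOfSetsType (uniform_prob (@ltr01 R)))) ae_unit_interval => u u01 _ /=.
    rewrite -EFinM; congr (_ * _)%:E; apply: ginv.
    - exact: z01.
    - by apply: z01; rewrite lexx ler01.
    - move=> j; case: (unliftP ord0 j) => [l|] -> ; last by rewrite iE eqxx.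
      by rewrite !(tnth_nth 0).
rewrite -integral12_prod_meas1//.
rewrite (ae_eq_integral (cst 0%E)) ?integral0//; first exact: (measurable_fubini_F hint).
apply: (@filterS2 _ _ (ae_filter_ringOfSetsType (uniform_prob (@ltr01 R)))) ae_unit_interval (ae_integrable1 gint') => u u01 gu _ /=; rewrite /fubini_F.
under eq_integral do rewrite dotp_cons mulrDr (addrC (2 * pi * (_ * _))) -addrA.
apply: (IH i' _ (fun x => g (cube_cons (u, x)))).
- by rewrite ffunE -iE.
- exact: gu.
- move=> x y x01 y01 xy; apply: ginv.
  + move=> j; case: (unliftP ord0 j) => [l|] ->; rewrite (tnth_nth 0)//=.
    by have := x01 l; rewrite (tnth_nth 0).
  + move=> j; case: (unliftP ord0 j) => [l|] ->; rewrite (tnth_nth 0)//=.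
    by have := y01 l; rewrite (tnth_nth 0).
  + move=> j; case: (unliftP ord0 j) => [l|] ->; rewrite !(tnth_nth 0)//= => lj.
    have /xy : l != i' by apply: contra lj => /eqP ->; rewrite iE.
    by rewrite !(tnth_nth 0).
Qed.

Lemma dotpD d (k l : freq d) (x : d.-tuple R) : dotp (k + l) x = dotp k x + dotp l x.
Proof.
by rewrite /dotp -big_split; apply: eq_bigr => i _ /=; rewrite ffunE intrD mulrDl.
Qed.

Lemma dotpN d (k : freq d) (x : d.-tuple R) : dotp (- k) x = - dotp k x.
Proof.
by rewrite /dotp -sumrN; apply: eq_bigr => i _ /=; rewrite ffunE mulrNz mulNr.
Qed.

Lemma freq_neq0P d (k : freq d) : k != 0 -> exists i, k i != 0.
Proof.
move=> k0; apply/existsP; apply: contraNT k0; rewrite negb_exists => /forallP k0.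
by apply/eqP/ffunP => i; rewrite ffunE; apply/eqP; rewrite -[_ == _]negbK.
Qed.

Lemma integral_cube_cos_freq d (k : freq d) (c : R) :
  (\int[cube_prob d]_x (cos (2 * pi * dotp k x + c))%:E =
   (if k == 0 then cos c else 0)%:E)%E.
Proof.
case: eqVneq => [->|/freq_neq0P[i ki]].
  under eq_integral.
    move=> x _; rewrite (_ : dotp _ x = 0) ?mulr0 ?add0r; first by over.
    by rewrite /dotp big1// => i _; rewrite ffunE mul0r.
  by rewrite integral_cst// [X in (_ * X)%E]probability_setT mule1.
rewrite -[RHS](integral_cube_cos (i := i) (k := k) (g := cst 1) c)//.
  by apply: eq_integral => x _; rewrite mul1r.
by apply: (@probability_bounded_integrable _ _ _ _ 1) => // x /=; rewrite normr1.
Qed.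

(** As [sin t = cos (t - pi / 2)], every nonconstant basis function is a shifted cosine, so one
    integral formula serves both families. *)
Definition phase d (k : freq d) : R := if first_pos k then 0 else - (pi / 2).

Lemma fourierE d (k : freq d) (x : d.-tuple R) : k != 0 ->
  fourier k x = Num.sqrt 2 * cos (2 * pi * dotp k x + phase k).
Proof.
move=> k0; rewrite /fourier /phase.
have -> : (k == [ffun=> 0]) = false.
  by apply: contraNF k0 => /eqP ->; apply/eqP/ffunP => i; rewrite !ffunE.
by case: ifP => _; rewrite ?addr0// cosBpihalf.
Qed.

Lemma fourier_measurable d (k : freq d) : k != 0 -> measurable_fun setT (@fourier R d k).
Proof.
move=> k0; rewrite (funext (fun x => fourierE x k0)).
by apply: measurable_funM => //; apply: measurable_cosD; exact: measurable_dotp.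
Qed.

Lemma fourier_bound d (k : freq d) (x : d.-tuple R) : k != 0 -> `|fourier k x| <= Num.sqrt 2.
Proof.
move=> k0; rewrite fourierE// normrM ger0_norm ?sqrtr_ge0//.
by rewrite ler_piMr ?sqrtr_ge0// cos_bound.
Qed.

Lemma integrable_sqr_Lfun2 d (T : measurableType d) (m : {measure set T -> \bar R})
    (g : T -> R) : measurable_fun setT g -> m.-integrable setT (fun x => (g x ^+ 2)%:E) ->
  g \in Lfun m 2%:E.
Proof.
move=> mg /integrableP[_ g2].
rewrite inE/=; apply/andP; split; rewrite inE//=.
rewrite /finite_norm unlock poweR_lty//.
under eq_integral => x _ do rewrite /= powR_mulrn// -normrX.
exact: g2.
Qed.

Lemma bounded_L2_cube d (g : d.-tuple R -> R) (M : R) : measurable_fun setT g ->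
  (forall x, `|g x| <= M) -> L2_cube g.
Proof.
move=> mg gM; apply: integrable_sqr_Lfun2 => //.
apply: (@probability_bounded_integrable _ _ _ _ (M ^+ 2)).
  exact: measurable_funX.
by move=> x; rewrite normrX; apply: lerXn2r; rewrite ?nnegrE// (le_trans _ (gM x)).
Qed.

Lemma fourier_L2 d (k : freq d) : k != 0 -> L2_cube (@fourier R d k).
Proof.
move=> k0; apply: bounded_L2_cube; first exact: fourier_measurable.
by move=> x; exact: fourier_bound.
Qed.

Lemma first_posN d (k : freq d) : k != 0 -> first_pos (- k) = ~~ first_pos k.
Proof.
move=> k0; have [i0 ki0] := freq_neq0P k0.
case: (@arg_minnP _ i0 (fun i => k i != 0) (@nat_of_ord d) ki0) => i ki imin.
have kz (j : 'I_d) : (j < i)%N -> k j == 0.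
  by move=> ji; apply: contraTT ji => /imin; rewrite -leqNgt.
have fpE (l : freq d) : (forall j : 'I_d, (j < i)%N -> l j == 0) -> l i != 0 -> first_pos l = (0 < l i).
  move=> lz li; apply/existsP/idP => [[j /andP[lj /forallP jz]]|li0]; last first.
    by exists i; rewrite li0; apply/forallP => j; apply/implyP; exact: lz.
  have [ij|ji|/val_inj ->//] := ltngtP i j.
    by have := jz i; rewrite ij (negbTE li).
  by move: lj; rewrite (eqP (lz _ ji)).
rewrite fpE ?(fpE k)// ?ffunE ?oppr_eq0//; last first.
  by move=> j /kz; rewrite ffunE oppr_eq0.
by rewrite oppr_gt0 lt_neqAle -leNgt ki.
Qed.

Lemma fourier_orthonormal d (k l : freq d) : k != 0 -> l != 0 ->
  inner_cube (@fourier R d k) (fourier l) = (k == l)%:R.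
Proof.
move=> k0 l0; rewrite /inner_cube /Rintegral.
have mc (h : freq d) (c : R) : (cube_prob d).-integrable setT
    (EFin \o (fun x => cos (2 * pi * dotp h x + c))).
  apply: (@probability_bounded_integrable _ _ _ _ 1); last by move=> x; exact: cos_bound.
  by apply: measurable_cosD; exact: measurable_dotp.
have E (x : d.-tuple R) : fourier k x * fourier l x =
    cos (2 * pi * dotp (k - l) x + (phase k - phase l)) +
    cos (2 * pi * dotp (k + l) x + (phase k + phase l)).
  rewrite !fourierE// mulrACA -expr2 sqr_sqrtr//.
  rewrite !dotpD dotpN (mulrBr (2 * pi) (dotp k x)) (mulrDr (2 * pi) (dotp k x)).
  set A := 2 * pi * dotp k x; set B := 2 * pi * dotp l x.
  rewrite (_ : A - B + _ = (A + phase k) - (B + phase l)); last by ring.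
  rewrite (_ : A + B + _ = (A + phase k) + (B + phase l)); last by ring.
  move: (A + phase k) (B + phase l) => u v.
  by rewrite cosD cosD cosN sinN; ring.
under eq_integral do rewrite E EFinD.
rewrite integralD_EFin//.
rewrite !integral_cube_cos_freq -EFinD/= subr_eq0 addr_eq0.
case: (eqVneq k l) => [->|kl].
  rewrite subrr cos0 ifN ?addr0//.
  apply: contraNN l0 => /eqP lN; apply/eqP/ffunP => i.
  have lNi : l i = - l i by rewrite [LHS](congr1 (fun h : freq d => h i) lN) ffunE.
  by rewrite [RHS]ffunE; move: (l i : int) lNi => a; lia.
(* Only [k = - l] could still contribute; then exactly one of the two functions is a sine, so the
   phases add up to [- pi / 2], where the cosine is 0. *)
rewrite add0r; case: eqVneq => // kN.
rewrite /phase kN first_posN//; case: first_pos => /=.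
  by rewrite addr0 cosN cos_pihalf.
by rewrite add0r cosN cos_pihalf.
Qed.

Lemma theta_eq0 d (f : d.-tuple R -> R) (J : {set 'I_d}) (k : freq d) (i : 'I_d)
    (fbar : #|J|.-tuple R -> R) : L2_cube f ->
  (forall x, unit_cube x -> f x = fbar (subvec J x)) ->
  k i != 0 -> i \notin J -> theta f k = 0.
Proof.
move=> f2 fJ ki iJ; have k0 : k != 0 by apply: contraNneq ki => ->; rewrite ffunE.
have f1 : (cube_prob d).-integrable setT (EFin \o f).
  apply/Lfun1_integrable; apply: Lfun_subset12 f2.
  by rewrite fin_num_measure.
rewrite /theta /inner_cube /Rintegral.
under eq_integral do rewrite fourierE// mulrCA EFinM.
rewrite integralZl//; last first.
  apply: (le_integrable measurableT _ _ f1) => /=.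
    apply/measurable_EFinP; apply: measurable_funM => //.
      by apply/measurable_EFinP; exact: measurable_int f1.
    by apply: measurable_cosD; exact: measurable_dotp.
  by move=> x _; rewrite lee_fin normrM ler_piMr// cos_bound.
rewrite (@integral_cube_cos _ i) ?mule0// => x y x01 y01 xy.
rewrite !fJ//; congr fbar; apply: eq_from_tnth => j; rewrite !tnth_mktuple.
by apply: xy; apply: contraNneq iJ => <-; exact: enum_valP.
Qed.
End fourier.

(** * Gaussian integrals *)

Section normal_integrals.
Context {R : realType}.
Local Notation mu := (@lebesgue_measure R).
Import HBNNSimple.

Let integral_normal_prob_nnsfun (m s : R) (f : {nnsfun measurableTypeR R >-> R}) :
  (\int[normal_prob m s]_x (f x)%:E = \int[mu]_x ((f x)%:E * (normal_pdf m s x)%:E))%E.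
Proof.
under [LHS]eq_integral do rewrite fimfunE -fsumEFin//.
rewrite [LHS]ge0_integral_fsum//; last 2 first.
  - by move=> r; exact/measurable_EFinP/measurableT_comp.
  - by move=> n x _; rewrite EFinM nnfun_muleindic_ge0.
have mpdf := @measurable_normal_pdf R m s.
under [RHS]eq_integral.
  move=> x xD; rewrite fimfunE -fsumEFin// ge0_mule_fsuml; last first.
    by move=> r; rewrite EFinM nnfun_muleindic_ge0.
  over.
rewrite [RHS]ge0_integral_fsum//; last 2 first.
  - move=> r; apply: emeasurable_funM; last exact/measurable_EFinP.
    by apply/measurable_EFinP; apply/measurableT_comp.
  - move=> n x _; rewrite EFinM mule_ge0//; first by rewrite nnfun_muleindic_ge0.
    by rewrite lee_fin normal_pdf_ge0.
apply: eq_fsbigr => r _.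
have [r0|r0] := ltP r 0.
  rewrite preimage_nnfun0// ; under eq_integral do rewrite indic0 mulr0.
  by under [RHS]eq_integral do rewrite indic0 mulr0 mul0e; rewrite !integral0.
have mf : measurable (f @^-1` [set r]) by exact: measurable_sfunP.
under eq_integral do rewrite EFinM.
rewrite ge0_integralZl//; last exact/measurable_EFinP/measurable_indic.
under [RHS]eq_integral do rewrite EFinM -muleA.
rewrite ge0_integralZl//; last 2 first.
  - by apply: emeasurable_funM; apply/measurable_EFinP => //; exact: measurable_indic.
  - by move=> x _; rewrite mule_ge0// lee_fin ?normal_pdf_ge0.
congr (_ * _)%E; rewrite integral_indic// setIT.
transitivity (\int[mu]_(x in f @^-1` [set r]) (normal_pdf m s x)%:E)%E => //.
rewrite [LHS]integral_mkcond.
apply: eq_integral => x _; rewrite patchE indicE.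
by case: ifPn => _; rewrite ?mul1e ?mul0e.
Qed.

Lemma integral_normal_prob (m s : R) (f : measurableTypeR R -> \bar R) :
  measurable_fun setT f -> (forall x, 0 <= f x)%E ->
  (\int[normal_prob m s]_x f x = \int[mu]_x (f x * (normal_pdf m s x)%:E))%E.
Proof.
move=> mf f0; have mpdf := @measurable_normal_pdf R m s.
pose f_ := nnsfun_approx measurableT mf.
transitivity (lim (\int[normal_prob m s]_x (f_ n x)%:E @[n --> \oo])%E).
  rewrite -monotone_convergence//=.
  - apply: eq_integral => ? /[!inE] xD; apply/esym/cvg_lim => //=.
    exact: cvg_nnsfun_approx.
  - by move=> n; apply/measurable_EFinP; exact: measurable_funPT.
  - by move=> n ? _; rewrite lee_fin.
  - by move=> ? _ ? ? mn; rewrite lee_fin; exact/lefP/nd_nnsfun_approx.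
rewrite [RHS](_ : _ = lim
    (\int[mu]_x ((f_ n x)%:E * (normal_pdf m s x)%:E) @[n --> \oo])%E); last first.
  rewrite -monotone_convergence//=.
  - apply: eq_integral => x _; apply/esym/cvg_lim => //.
    by apply: cvgeZr => //; exact: cvg_nnsfun_approx.
  - by move=> n; apply: emeasurable_funM; apply/measurable_EFinP => //; exact: measurable_funPT.
  - by move=> n ? _; rewrite -EFinM lee_fin mulr_ge0// normal_pdf_ge0.
  - move=> x _ ? ? mn; rewrite -!EFinM lee_fin ler_wpM2r ?normal_pdf_ge0//.
    exact/lefP/nd_nnsfun_approx.
by apply: congr_lim; apply/funext => n /=; exact: integral_normal_prob_nnsfun.
Qed.

Lemma normal_pdf_tilt (m s t x : R) : s != 0 ->
  expR (t * x) * normal_pdf m s x =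
  expR (m * t + s ^+ 2 * t ^+ 2 / 2) * normal_pdf (m + s ^+ 2 * t) s x.
Proof.
move=> s0; rewrite /normal_pdf (negbTE s0) /normal_fun !(mulrCA (expR _)) -!expRD.
congr (_ * expR _); rewrite -mulr_natr; field.
by rewrite s0.
Qed.

(** A Gaussian weight divides the variance by [1 + 2 c s^2]. A negative [c] is allowed as long as
    this factor stays positive; [mgf_quad] takes [c = - a]. *)
Lemma normal_pdf_quad (m s c x : R) : s != 0 -> 0 < 1 + 2 * c * s ^+ 2 ->
  expR (- (c * (x - m) ^+ 2)) * normal_pdf m s x =
  (Num.sqrt (1 + 2 * c * s ^+ 2))^-1 *
  normal_pdf m (s / Num.sqrt (1 + 2 * c * s ^+ 2)) x.
Proof.
move=> s0 w0; set w := Num.sqrt _.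
have w_gt0 : 0 < w by rewrite sqrtr_gt0.
have w2 : w ^+ 2 = 1 + 2 * c * s ^+ 2 by rewrite sqr_sqrtr// ltW.
have sw0 : s / w != 0 by rewrite mulf_neq0// invr_neq0// gt_eqF.
rewrite /normal_pdf (negbTE s0) (negbTE sw0) /normal_fun mulrCA -expRD mulrA; congr (_ * expR _).
  rewrite /normal_peak exprMn exprVn -invfM; congr (_^-1).
  have wE : w = Num.sqrt (w ^+ 2) by rewrite sqrtr_sqr ger0_norm// ltW.
  rewrite [X in _ = X * _]wE -sqrtrM ?sqr_ge0//; congr (Num.sqrt _).
  have Q (p u v : R) : v != 0 -> u * p *+ 2 = v * (u / v * p *+ 2).
    by move=> v0; field.
  by apply: Q; rewrite gt_eqF// exprn_gt0.
rewrite exprMn exprVn w2; field.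
by rewrite gt_eqF// s0.
Qed.

Lemma integral_exp_normal_pdf (m s t : R) : s != 0 ->
  (\int[mu]_x (expR (t * x) * normal_pdf m s x)%:E =
   (expR (m * t + s ^+ 2 * t ^+ 2 / 2))%:E)%E.
Proof.
move=> s0; under eq_integral do rewrite normal_pdf_tilt// EFinM.
rewrite integralZl//; last exact: integrable_normal_pdf.
by rewrite integral_normal_pdf mule1.
Qed.

Lemma integral_exp_quad_normal_pdf (m s c : R) : s != 0 -> 0 < 1 + 2 * c * s ^+ 2 ->
  (\int[mu]_x (expR (- (c * (x - m) ^+ 2)) * normal_pdf m s x)%:E =
   ((Num.sqrt (1 + 2 * c * s ^+ 2))^-1)%:E)%E.
Proof.
move=> s0 w0; under eq_integral do rewrite normal_pdf_quad// EFinM.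
rewrite integralZl//; last exact: integrable_normal_pdf.
by rewrite integral_normal_pdf mule1.
Qed.

Lemma gaussian_integral d (T : measurableType d) (P : probability T R) (X : T -> R) :
  measurable_fun setT X -> is_gaussian P X ->
  exists m s : R, forall f : R -> R, measurable_fun setT f -> (forall x, 0 <= f x) ->
    (\int[P]_w (f (X w))%:E =
     if (s == 0)%R then (f m)%:E else \int[mu]_x (f x * normal_pdf m s x)%:E)%E.
Proof.
move=> mX [m [s law]]; exists m, s => f mf f0.
have mf' : measurable_fun [set: measurableTypeR R] (fun x : measurableTypeR R => (f x)%:E).
  exact/measurable_EFinP.
have -> : (\int[P]_w (f (X w))%:E =
    \int[pushforward P (X : T -> measurableTypeR R)]_x (f x)%:E)%E.
  by rewrite ge0_integral_pushforward// => x _; rewrite lee_fin.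
case: ifPn => s0.
  rewrite (eq_measure_integral (@dirac _ (measurableTypeR R) m R)).
    by rewrite integral_dirac// diracT mul1e.
  by move=> A mA _; have := law A mA; rewrite s0.
rewrite (eq_measure_integral (normal_prob m s)).
  by rewrite integral_normal_prob// => x; rewrite lee_fin.
by move=> A mA _; have := law A mA; rewrite (negbTE s0).
Qed.

(** First-order comparison at [c = 0]: the inverse square root is [1 - c s2 + O(c^2)], which forces
    [s2 <= v]. One explicit small [c] replaces the limit. *)
Lemma sqrt_mgf_ineq (v s2 : R) : 0 <= v -> 0 <= s2 ->
  (forall c, 0 < c -> 1 <= (Num.sqrt (1 + 2 * c * s2))^-1 + c * v) -> s2 <= v.
Proof.
move=> v0 s0 H; rewrite leNgt; apply/negP => vs.
have s2_gt0 : 0 < s2 by exact: le_lt_trans vs.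
(* With [u = c s2] this choice gives [v = s2 (1 - 4 u)]; since [w <= 1 + u], the assumption yields
   [2 s2 <= v (2 + 3 u)], that is [s2 (5 u + 12 u^2) <= 0], a contradiction. *)
pose c := (s2 - v) / (4 * s2 ^+ 2).
have c0 : 0 < c by rewrite divr_gt0 ?subr_gt0// mulr_gt0 ?exprn_gt0.
have cE : c * (4 * s2 ^+ 2) = s2 - v.
  by rewrite /c divfK// mulf_neq0// ?expf_neq0// gt_eqF.
have := H _ c0; set w := Num.sqrt _.
have cs0 : 0 <= c * s2 by rewrite mulr_ge0// ltW.
have w2 : w ^+ 2 = 1 + 2 * c * s2 by rewrite /w sqr_sqrtr//; move: (c) cs0 => e; nra.
have w0 : 0 <= w by rewrite /w sqrtr_ge0.
have w1 : 1 <= w by move: (c) (w) w2 w0 cs0 => e u; clear; nra.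
rewrite -(ler_pM2r (lt_le_trans ltr01 w1)) mul1r mulrDl mulVf ?gt_eqF// ?(lt_le_trans ltr01)//.
move: (c) c0 cE w2 w1 => e e0 eE w2 w1 Hw.
have A : 2 * e * s2 <= e * v * w * (w + 1) by nra.
have B : 2 * s2 <= v * w * (w + 1).
  by rewrite -(ler_pM2l e0); move: A; nra.
have [u u0 uE] : exists2 u, 0 < u & u = e * s2 by exists (e * s2) => //; rewrite mulr_gt0.
have vE : v = s2 * (1 - 4 * u) by rewrite uE; lra.
have wu : w ^+ 2 = 1 + 2 * u by rewrite w2 uE mulrA.
have wle : w <= 1 + u by move: (w) wu w0 u0 => y; clear; nra.
have C : v * w * (w + 1) <= v * (2 + 3 * u).
  rewrite -mulrA ler_wpM2l//; move: (w) wu wle => y; clear; lra.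
have : s2 * (5 * u + 12 * u ^+ 2) <= 0.
  by move: (w) B C vE => y; clear; nra.
apply/negP; rewrite -ltNge mulr_gt0// addr_gt0// mulr_gt0// exprn_gt0//.
Qed.

(* [E X = e] forces the mean parameter to be [e], because [1 + t (X - e) <= exp (t (X - e))]
   integrates to [1 <= exp ((m - e) t + s^2 t^2 / 2)] for all [t]; the bound
   [s^2 <= v] follows from [1 - exp (- c (X - e)^2) <= c (X - e)^2] as [c] tends to 0. *)
Lemma gaussian_mgf d (T : measurableType d) (P : probability T R) (X : T -> R) (e v : R) :
  measurable_fun setT X -> is_gaussian P X ->
  P.-integrable setT (EFin \o X) -> (\int[P]_w (X w)%:E = e%:E)%E ->
  (\int[P]_w ((X w - e) ^+ 2)%:E = v%:E)%E ->
  (\int[P]_w (expR (X w - e))%:E <= (expR (v / 2))%:E)%E.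
Proof.
move=> mX gX iX Xe Xv.
have v0 : 0 <= v by rewrite -lee_fin -Xv integral_ge0// => w _; rewrite lee_fin sqr_ge0.
have [m [s law]] := gaussian_integral mX gX.
have mexp (t : R) : measurable_fun setT (fun x : R => expR (t * (x - e))).
  by apply: measurableT_comp => //; apply: measurable_funM => //; exact: measurable_funB.
have mgf (t : R) : (\int[P]_w (expR (t * (X w - e)))%:E =
    (expR ((m - e) * t + s ^+ 2 * t ^+ 2 / 2))%:E)%E.
  rewrite (law (fun x => expR (t * (x - e))))//.
  case: ifPn => [/eqP ->|s0]; first by rewrite expr0n /= !mul0r addr0 mulrC.
  under eq_integral do rewrite mulrBr expRD (mulrC (expR (t * _))) -mulrA EFinM.
  rewrite ge0_integralZl//; last first.
  - by move=> x _; rewrite lee_fin mulr_ge0 ?expR_ge0 ?normal_pdf_ge0.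
  - apply/measurable_EFinP; apply: measurable_funM; last exact: measurable_normal_pdf.
    by apply: measurableT_comp => //; exact: measurable_funM.
  by rewrite integral_exp_normal_pdf// -EFinM -expRD; congr (expR _)%:E; ring.
have iexp (t : R) : P.-integrable setT (fun w => (expR (t * (X w - e)))%:E).
  apply/integrableP; split.
    by apply/measurable_EFinP; exact: (measurableT_comp (mexp t) mX).
  under eq_integral do rewrite gee0_abs ?lee_fin ?expR_ge0//.
  by rewrite mgf ltry.
have icst (c : R) : P.-integrable setT (cst c%:E) by exact: finite_measure_integrable_cst.
have Icst (c : R) : (\int[P]_w (cst c%:E) w = c%:E)%E.
  by rewrite integral_cst// [X in (_ * X)%E]probability_setT mule1.
have m0 : m - e = 0.
  have H (t : R) : 0 <= (m - e) * t + s ^+ 2 * t ^+ 2 / 2.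
    rewrite -[leLHS]expRK -[leRHS]expRK ler_ln ?posrE ?expR_gt0// expR0.
    rewrite -lee_fin -mgf.
    have iZ : P.-integrable setT ((cst (1 - t * e)%:E) \+ (fun w => t%:E * (X w)%:E))%E.
      by apply: integrableD => //; exact: integrableZl.
    have EZ w : ((1 + t * (X w - e))%:E = ((cst (1 - t * e)%:E) \+ (fun w => t%:E * (X w)%:E)) w)%E.
      by rewrite /= -EFinM -EFinD; congr EFin; ring.
    have -> : (1%:E = \int[P]_w (1 + t * (X w - e))%:E)%E.
      under eq_integral do rewrite EZ.
      rewrite integralD//; last exact: integrableZl.
      rewrite Icst integralZl// Xe -EFinM -EFinD; congr EFin; ring.
    apply: le_integral => //.
    - by apply: (eq_integrable _ _ _ _ iZ) => // w _; rewrite -EZ.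
    - by move=> w _; rewrite lee_fin expR_ge1Dx.
  have s2 : 0 <= s ^+ 2 by exact: sqr_ge0.
  (* This [t] makes the quadratic equal to [- t^2 (s^2 / 2 + 1)]; the [+ 1] keeps the denominator
     positive when [s = 0]. *)
  have := H (- (m - e) / (s ^+ 2 + 1)); set q := s ^+ 2; move: (m - e) => p.
  have q1 : 0 < q + 1 by rewrite ltr_wpDl.
  set u := - p / (q + 1) => Hu.
  have um : u * (q + 1) = - p by rewrite /u divfK// gt_eqF.
  have : u ^+ 2 * (q / 2 + 1) <= 0 by nra.
  have : 0 <= u ^+ 2 by exact: sqr_ge0.
  move=> e2 eq; have : u ^+ 2 = 0 by nra.
  by move=> /eqP; rewrite sqrf_eq0 => /eqP u0; rewrite u0 mul0r in um; lra.
have sv : s ^+ 2 <= v.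
  have [->|s0] := eqVneq s 0; first by rewrite expr0n.
  apply: sqrt_mgf_ineq => //; first exact: sqr_ge0.
  move=> c c0; rewrite -lee_fin EFinD EFinM -Xv.
  have w0 : 0 < 1 + 2 * c * s ^+ 2.
    by rewrite ltr_wpDr//; apply: mulr_ge0; [rewrite mulr_ge0// ltW|exact: sqr_ge0].
  have msub : measurable_fun setT (fun x : R => x - e) by exact: measurable_funB.
  have mq : measurable_fun setT (fun x : R => expR (- (c * (x - e) ^+ 2))).
    apply: measurableT_comp => //; apply: measurable_funN; apply: measurable_funM => //.
    exact: measurable_funX.
  have mX2 : measurable_fun setT (fun w => (X w - e) ^+ 2).
    by apply: measurable_funX; exact: (measurableT_comp msub mX).
  have <- : (\int[P]_w (expR (- (c * (X w - e) ^+ 2)))%:E =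
      ((Num.sqrt (1 + 2 * c * s ^+ 2))^-1)%:E)%E.
    rewrite (law (fun x => expR (- (c * (x - e) ^+ 2))))// (negbTE s0).
    have -> : e = m by lra.
    by rewrite integral_exp_quad_normal_pdf.
  rewrite -ge0_integralZl//; last 3 first.
  - exact/measurable_EFinP.
  - by move=> w _; rewrite lee_fin sqr_ge0.
  - by rewrite lee_fin ltW.
  rewrite -ge0_integralD//; last 3 first.
  - by apply/measurable_EFinP; exact: (measurableT_comp mq mX).
  - by move=> w _; rewrite -EFinM lee_fin mulr_ge0 ?sqr_ge0// ltW.
  - by apply/measurable_EFinP; exact: measurable_funM.
  rewrite -[leLHS]Icst.
  apply: ge0_le_integral => //.
  - apply: emeasurable_funD; apply/measurable_EFinP; last exact: measurable_funM.
    exact: (measurableT_comp mq mX).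
  - by move=> w _; rewrite -EFinM -EFinD lee_fin -lerBlDr expR_ge1Dx.
have := mgf 1; under eq_integral do rewrite mul1r.
move=> ->; rewrite lee_fin ler_expR m0 mul0r add0r expr1n mulr1.
by rewrite ler_pM2r// invr_gt0.
Qed.
End normal_integrals.

(** * Exponential moments of quadratic forms *)

Section quadratic_mgf.
Context {R : realType} d (T : measurableType d) (P : probability T R).
Local Notation mu := (@lebesgue_measure R).
Variables (N : nat) (xi : nat -> T -> R).
Hypothesis mxi : forall i, measurable_fun setT (xi i).
Hypothesis mgf_lin : forall b : nat -> R,
  (\int[P]_w (expR (\sum_(i < N) b i * xi i w))%:E
     <= (expR (\sum_(i < N) b i ^+ 2 / 2))%:E)%E.

Lemma measurable_sum_lin (b : nat -> R) (Q : pred 'I_N) :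
  measurable_fun setT (fun w => \sum_(i < N | Q i) b i * xi i w).
Proof.
by under eq_fun do rewrite big_mkcond; apply: measurable_sum => i;
  case: (Q i) => //; exact: measurable_funM.
Qed.

Lemma measurable_sum_sqr (Q : pred 'I_N) :
  measurable_fun setT (fun w => \sum_(i < N | Q i) xi i w ^+ 2).
Proof.
by under eq_fun do rewrite big_mkcond; apply: measurable_sum => i;
  case: (Q i) => //; exact: measurable_funX.
Qed.

(* The first [r] variables enter quadratically. Raising [r] uses
   [exp (a x^2) = E exp (sqrt (2 a) g x)] with [g] standard normal, which turns
   the quadratic term into a linear one without any independence. *)
Lemma mgf_quad (a : R) (r : nat) (b : nat -> R) : 0 <= a -> a < 1 / 2 -> (r <= N)%N ->
  (\int[P]_w (expR (a * (\sum_(i < N | (i < r)%N) xi i w ^+ 2) +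
                    \sum_(i < N | (r <= i)%N) b i * xi i w))%:E
   <= ((Num.sqrt (1 - 2 * a))^-1 ^+ r * expR (\sum_(i < N | (r <= i)%N) b i ^+ 2 / 2))%:E)%E.
Proof.
move=> a0 a2; elim: r b => [|r IH] b rN.
  rewrite expr0 mul1r; under eq_integral do rewrite big_pred0_eq mulr0 add0r.
  exact: mgf_lin.
set K := (Num.sqrt _)^-1.
have K0 : 0 <= K by rewrite invr_ge0 sqrtr_ge0.
pose h w := a * (\sum_(i < N | (i < r)%N) xi i w ^+ 2) +
  \sum_(i < N | (r < i)%N) b i * xi i w.
pose q := Num.sqrt (2 * a).
have q2 : q ^+ 2 = 2 * a by rewrite sqr_sqrtr// mulr_ge0.
pose F (z : T * measurableTypeR R) : \bar R :=
  (expR (h z.1 + q * z.2 * xi r z.1) * normal_pdf 0 1 z.2)%:E.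
have one0 : (1 : R) != 0 by exact: oner_neq0.
have mh : measurable_fun setT h.
  apply: measurable_funD; last exact: measurable_sum_lin.
  by apply: measurable_funM => //; exact: measurable_sum_sqr.
have mF : measurable_fun setT F.
  apply/measurable_EFinP; apply: measurable_funM; last first.
    exact: (measurableT_comp (@measurable_normal_pdf R 0 1) measurable_snd).
  apply: measurableT_comp => //; apply: measurable_funD.
    exact: (measurableT_comp mh measurable_fst).
  apply: measurable_funM; last exact: (measurableT_comp (mxi r) measurable_fst).
  by apply: measurable_funM => //; exact: measurable_snd.
have F0 z : (0 <= F z)%E by rewrite lee_fin mulr_ge0// ?expR_ge0// normal_pdf_ge0.
have sumr (G : nat -> R) : \sum_(i < N | (r <= i)%N) G i = G r + \sum_(i < N | (r < i)%N) G i.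
  rewrite (bigD1 (Ordinal rN))//=; congr (_ + _); apply: eq_bigl => i.
  by rewrite ltn_neqAle -val_eqE /= eq_sym andbC.
have sumq w : \sum_(i < N | (i < r.+1)%N) xi i w ^+ 2 =
    \sum_(i < N | (i < r)%N) xi i w ^+ 2 + xi r w ^+ 2.
  rewrite (bigD1 (Ordinal rN))//= addrC; congr (_ + _); apply: eq_bigl => i.
  by rewrite ltnS ltn_neqAle -val_eqE andbC.
have E w : (expR (a * (\sum_(i < N | (i < r.+1)%N) xi i w ^+ 2) +
                    \sum_(i < N | (r < i)%N) b i * xi i w))%:E =
     (\int[mu]_g F (w, g))%E.
  rewrite /F/=; under eq_integral do rewrite expRD -mulrA EFinM (mulrAC q).
  rewrite ge0_integralZl//=; last 2 first.
  - apply/measurable_EFinP; apply: measurable_funM; last exact: measurable_normal_pdf.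
    by apply: measurableT_comp => //; exact: measurable_funM.
  - by move=> x _; rewrite lee_fin mulr_ge0 ?expR_ge0 ?normal_pdf_ge0.
  rewrite integral_exp_normal_pdf// mul0r add0r expr1n mul1r -EFinM -expRD.
  congr (expR _)%:E; rewrite exprMn q2 sumq /h.
  by field.
under eq_integral do rewrite E.
rewrite (fubini_tonelli (m1 := P) (m2 := mu) F)//.
(* For fixed [g] the variable [r] enters linearly with coefficient [q g], so the induction
   hypothesis applies to the modified coefficients; the new one contributes the factor
   [expR (a g^2)]. *)
pose c g i := if i == r then q * g else b i.
have bound (g : R) : (\int[P]_w F (w, g) <=
   ((K ^+ r * expR (\sum_(i < N | (r < i)%N) b i ^+ 2 / 2)) )%:E *
   (expR (- (- a * g ^+ 2)) * normal_pdf 0 1 g)%:E)%E.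
  rewrite /F/=; under eq_integral do rewrite mulrC EFinM.
  rewrite ge0_integralZl//=; last 2 first.
  - apply/measurable_EFinP; apply: measurableT_comp => //; apply: measurable_funD => //.
    exact: measurable_funM.
  - by rewrite lee_fin normal_pdf_ge0.
  rewrite [(_ * normal_pdf 0 1 g)%:E]EFinM muleA [leRHS]muleC lee_wpmul2l ?lee_fin ?normal_pdf_ge0//.
  apply: le_trans (_ : _ <= (K ^+ r * expR (\sum_(i < N | (r <= i)%N) c g i ^+ 2 / 2))%:E)%E _.
    apply: le_trans (IH (c g) (ltnW rN)).
    rewrite le_eqVlt; apply/orP; left; apply/eqP; apply: eq_integral => w _; congr (expR _)%:E.
    rewrite (sumr (fun i => c g i * xi i w)) /c eqxx /h -addrA; congr (_ + _).
    rewrite addrC; congr (_ + _).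
    by apply: eq_bigr => i ri; rewrite gtn_eqF.
  rewrite -EFinM lee_fin -mulrA ler_wpM2l ?exprn_ge0// -expRD ler_expR (sumr (fun i => c g i ^+ 2 / 2)) addrC.
  rewrite /c eqxx (eq_bigr (fun i : 'I_N => b i ^+ 2 / 2)); last by move=> i ri; rewrite gtn_eqF.
  by rewrite lerD2l exprMn q2 mulNr opprK; lra.
have mG : measurable_fun setT (fun g : R => (expR (- (- a * g ^+ 2)) * normal_pdf 0 1 g)%:E).
  apply/measurable_EFinP; apply: measurable_funM; last exact: measurable_normal_pdf.
  by apply: measurableT_comp => //; apply: measurable_funN; apply: measurable_funM.
apply: (@le_trans _ _ (\int[mu]_g
   ((K ^+ r * expR (\sum_(i < N | (r < i)%N) b i ^+ 2 / 2))%:E *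
   (expR (- (- a * g ^+ 2)) * normal_pdf 0 1 g)%:E))%E).
  apply: ge0_le_integral => //=.
  - by move=> g _; apply: integral_ge0.
  - exact: (measurable_fun_fubini_tonelli_G (m1 := P)).
  - exact: emeasurable_funM.
rewrite ge0_integralZl//=; last 2 first.
- by move=> x _; rewrite lee_fin mulr_ge0 ?expR_ge0 ?normal_pdf_ge0.
- by rewrite lee_fin mulr_ge0 ?expR_ge0// exprn_ge0.
(* Averaging [expR (a g^2)] over a standard normal gives one more factor [K]; this needs
   [a < 1 / 2]. *)
have -> : (\int[mu]_x (expR (- (- a * x ^+ 2)) * normal_pdf 0 1 x)%:E = K%:E)%E.
  have : 0 < 1 + 2 * (- a) * 1 ^+ 2 by rewrite expr1n; lra.
  move=> /(integral_exp_quad_normal_pdf 0 one0).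
  under eq_integral do rewrite subr0.
  by move=> ->; rewrite expr1n mulr1 mulrN.
rewrite -EFinM lee_fin exprSr -!mulrA ler_wpM2l ?exprn_ge0//.
by rewrite mulrC.
Qed.

Let S w := \sum_(i < N) (xi i w ^+ 2 - 1).

Lemma measurable_chi2 : measurable_fun setT S.
Proof. by apply: measurable_sum => i; apply: measurable_funB => //; exact: measurable_funX. Qed.

(** It suffices that [(1 - 2 a)^(-1/2) <= expR (a + 4 a^2)], the factor [expR a] being absorbed by
    the centring. After squaring, this follows from [(1 + 2 a + 8 a^2) (1 - 2 a) = 1 + 4 a^2 (1 - 4
    a) >= 1], which is where [a <= 1 / 4] comes from. *)
Lemma mgf_chi2 (a : R) : 0 <= a -> a <= 1 / 4 ->
  (\int[P]_w (expR (a * S w))%:E <= (expR (4 * a ^+ 2 * N%:R))%:E)%E.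
Proof.
move=> a0 a4; have a2 : a < 1 / 2 by lra.
have := mgf_quad (fun=> 0) a0 a2 (leqnn N).
set K := (Num.sqrt _)^-1.
have K0 : 0 <= K by rewrite invr_ge0 sqrtr_ge0.
have KE : K <= expR (a + 4 * a ^+ 2).
  rewrite -(ler_pXn2r (n := 2))// ?nnegrE ?expR_ge0// exprVn sqr_sqrtr ?subr_ge0; last lra.
  rewrite -expRM_natl -[leLHS]div1r ler_pdivrMr; last lra.
  have : 1 + 2 * (a + 4 * a ^+ 2) <= expR (2 * (a + 4 * a ^+ 2)) by exact: expR_ge1Dx.
  move: (expR _) => y yge.
  apply: (@le_trans _ _ ((1 + 2 * (a + 4 * a ^+ 2)) * (1 - 2 * a))).
    have : 0 <= a ^+ 2 * (1 - 4 * a) by rewrite mulr_ge0 ?sqr_ge0//; lra.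
    by lra.
  by rewrite ler_wpM2r//; lra.
have E0 w : \sum_(i < N | (N <= i)%N) 0 * xi i w = 0 by apply: big1 => i _; rewrite mul0r.
rewrite [X in (K ^+ N * expR X)%:E]big1; last by move=> i _; rewrite expr0n mul0r.
under eq_integral do rewrite E0 addr0.
rewrite expR0 mulr1 => H.
have EE w : expR (a * S w) = expR (- (a * N%:R)) *
    expR (a * (\sum_(i < N | (i < N)%N) xi i w ^+ 2)).
  rewrite -expRD /S sumrB mulrBr addrC sumr_const card_ord; congr (expR (_ + a * _)).
  by apply: eq_bigl => i; rewrite ltn_ord.
under eq_integral do rewrite EE EFinM.
rewrite ge0_integralZl//; last first.
  apply/measurable_EFinP; apply: measurableT_comp => //; apply: measurable_funM => //.
  exact: measurable_sum_sqr.
apply: le_trans (lee_wpmul2l _ H) _; first by rewrite lee_fin expR_ge0.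
rewrite -EFinM lee_fin -(ler_pM2l (expR_gt0 (a * N%:R))) mulrA -expRD subrr expR0 mul1r -expRD.
apply: le_trans (lerXn2r N _ _ KE) _; rewrite ?nnegrE ?expR_ge0//.
by rewrite -expRM_natl ler_expR -mulr_natl mulrDr; lra.
Qed.

Lemma markov_exp (X : T -> R) (M c : R) : measurable_fun setT X ->
  (\int[P]_w (expR (X w))%:E <= M%:E)%E -> (P [set w | (c <= X w)%R] <= (M * expR (- c))%:E)%E.
Proof.
move=> mX XM.
have mA : measurable [set w | c <= X w].
  by rewrite -[X in measurable X]setTI; exact: measurable_fun_ler.
rewrite expRN EFinM lee_pdivlMr ?expR_gt0//; apply: le_trans XM.
rewrite muleC -[P _]mul1e -integral_cst// -ge0_integralZl//.
apply: le_trans (_ : _ <= \int[P]_(w in [set w | (c <= X w)%R]) (expR (X w))%:E)%E _.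
  apply: ge0_le_integral => //.
  - by move=> w _; rewrite mule1 lee_fin expR_ge0.
  - by apply/measurable_EFinP; apply: measurableT_comp => //; exact: measurable_funTS.
  - by move=> w /= cX; rewrite mule1 lee_fin ler_expR.
apply: ge0_subset_integral => //.
by apply/measurable_EFinP; apply: measurableT_comp.
Qed.

Lemma chi2_upper_tail (a x : R) : 0 <= a -> a <= 1 / 4 ->
  (P [set w | (x <= S w)%R] <= (expR (4 * a ^+ 2 * N%:R - a * x))%:E)%E.
Proof.
move=> a0 a4; apply: (@le_trans _ _ (P [set w | (a * x <= a * S w)%R])%E).
  apply: le_measure; rewrite ?inE.
  - rewrite -[X in measurable X]setTI; apply: measurable_fun_ler => //.
    exact: measurable_chi2.
  - rewrite -[X in measurable X]setTI; apply: measurable_fun_ler => //.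
    by apply: measurable_funM => //; exact: measurable_chi2.
  - by move=> w /= xS; exact: ler_wpM2l.
rewrite expRD; apply: markov_exp; last exact: mgf_chi2.
by apply: measurable_funM => //; exact: measurable_chi2.
Qed.

(* As [E S = 0], the nonnegative variable [exp (a S) - 1 - a S] has mean at most
   [exp (4 a^2 N) - 1]; it is at least [exp (- 1)] when [a S <= - 1]. *)
Lemma chi2_lower_tail (t : R) : 4 <= t ->
  P.-integrable setT (EFin \o S) -> (\int[P]_w (S w)%:E = 0)%E ->
  (P [set w | (S w <= - t)%R] <= (expR 1 * (expR (4 * t^-1 ^+ 2 * N%:R) - 1))%:E)%E.
Proof.
move=> t4 iS S0; have t0 : 0 < t by lra.
set a := t^-1; have a0 : 0 < a by rewrite invr_gt0.
have a4 : a <= 1 / 4 by rewrite -(ler_pM2r t0) mulVf ?gt_eqF//; lra.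
have mS := measurable_chi2.
pose G w := expR (a * S w) - (1 + a * S w).
have G0 w : 0 <= G w by rewrite subr_ge0 expR_ge1Dx.
have mexp : measurable_fun setT (fun w => expR (a * S w)).
  by apply: measurableT_comp => //; exact: measurable_funM.
have mG : measurable_fun setT G.
  by apply: measurable_funB => //; apply: measurable_funD => //; exact: measurable_funM.
have iexp : P.-integrable setT (EFin \o (fun w => expR (a * S w))).
  apply/integrableP; split; first exact/measurable_EFinP.
  under eq_integral do rewrite /= ger0_norm ?expR_ge0//.
  exact: le_lt_trans (mgf_chi2 (ltW a0) a4) (ltry _).
have i1 : P.-integrable setT (EFin \o (fun w => 1 + a * S w)).
  apply: (@eq_integrable _ _ _ _ _ _ ((cst 1%:E) \+ (fun w => a%:E * (S w)%:E))%E) => //.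
  by apply: integrableD => //; [exact: finite_measure_integrable_cst|exact: integrableZl].
have IG : (\int[P]_w (G w)%:E <= (expR (4 * a ^+ 2 * N%:R) - 1)%:E)%E.
  under eq_integral do rewrite EFinB.
  rewrite integralB_EFin// EFinB; apply: leeB; first exact: mgf_chi2 (ltW a0) a4.
  under eq_integral do rewrite EFinD EFinM.
  rewrite integralD//; [|exact: finite_measure_integrable_cst|exact: integrableZl].
  rewrite integral_cst// [X in (_ * X)%E]probability_setT mule1 integralZl//.
  by rewrite S0 mule0 adde0.
have mA : measurable [set w | S w <= - t].
  by rewrite -[X in measurable X]setTI; exact: measurable_fun_ler.
rewrite EFinM -lee_pdivrMl ?expR_gt0//; apply: le_trans IG.
rewrite -[P _]mul1e -integral_cst// -ge0_integralZl//.
apply: le_trans (_ : _ <= \int[P]_(w in [set w | (S w <= - t)%R]) (G w)%:E)%E _.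
  apply: ge0_le_integral => //.
  - by move=> w _; rewrite mule1 lee_fin invr_ge0 expR_ge0.
  - by apply/measurable_EFinP; exact: measurable_funTS.
  - move=> w /= St; rewrite mule1 lee_fin /G.
    have u1 : a * S w <= - 1.
      by have := ler_wpM2l (ltW a0) St; rewrite mulrN mulVf// gt_eqF.
    rewrite -expRN; move: (a * S w) u1 => u u1.
    (* The tangent at [- 1] gives [expR u - 1 - u >= expR (- 1) + (1 + u) (expR (- 1) - 1)], and
       both factors of the last product are at most 0. *)
    have Eu : expR u = expR (- 1) * expR (u + 1) by rewrite -expRD; congr expR; lra.
    have : expR (- 1) * (1 + (u + 1)) <= expR u.
      by rewrite Eu ler_wpM2l ?expR_ge0// expR_ge1Dx.
    have : expR (- 1) <= 1 :> R by rewrite -[leRHS]expR0 ler_expR; lra.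
    by move: (expR (- 1)) (expR u) => y z; nra.
apply: ge0_subset_integral => //; first exact/measurable_EFinP.
by move=> w _; rewrite lee_fin.
Qed.
End quadratic_mgf.

(** * The white noise model *)

Section white_noise.
Context {R : realType}.

(** The integral is a difference of those of the positive and negative parts, so a real value forces
    both to be finite. The mean and covariance equations of the model thus also certify
    integrability. *)
Lemma finite_integral_integrable d (T : measurableType d) (m : {measure set T -> \bar R})
    (g : T -> R) (r : R) : measurable_fun setT g -> (\int[m]_x (g x)%:E = r%:E)%E ->
  m.-integrable setT (EFin \o g).
Proof.
move=> mg gr; apply/integrableP; split; first exact/measurable_EFinP.
apply/abse_integralP => //; first exact/measurable_EFinP.
by rewrite [X in `|X|%E]gr ltry.
Qed.

Variables (n d : nat) (f : d.-tuple R -> R).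
Variables (disp : measure_display) (Omega : measurableType disp) (P : probability Omega R).
Variable Y : (d.-tuple R -> R) -> {RV P >-> R}.
Hypothesis n0 : (0 < n)%N.
Hypothesis wn : white_noise n f Y.
Variables (N : nat) (k : nat -> freq d).
Hypothesis k0 : forall i, k i != 0.
Hypothesis kinj : forall i j, (i < N)%N -> (j < N)%N -> k i = k j -> i = j.

Definition xi (i : nat) (w : Omega) : R :=
  Num.sqrt n%:R * (Y (fourier (k i)) w - theta f (k i)).

Lemma measurable_xi i : measurable_fun setT (xi i).
Proof. by apply: measurable_funM => //; exact: measurable_funB. Qed.

Lemma integral_noise i : (\int[P]_w (Y (fourier (k i)) w)%:E = (theta f (k i))%:E)%E.
Proof.
have [_ EY _] := wn.
by have := EY _ (fourier_L2 (k0 i)); rewrite unlock.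
Qed.

Lemma integral_xi2 i j : (i < N)%N -> (j < N)%N ->
  (\int[P]_w (xi i w * xi j w)%:E = (i == j)%:R%:E)%E.
Proof.
move=> iN jN; have [_ EY CY] := wn.
have := CY _ _ (fourier_L2 (k0 i)) (fourier_L2 (k0 j)).
rewrite fourier_orthonormal// unlock (EY _ (fourier_L2 (k0 i))) (EY _ (fourier_L2 (k0 j)))/= => C.
have kij : (k i == k j) = (i == j).
  by apply/eqP/eqP => [kk|->//]; exact: kinj kk.
rewrite {}kij in C.
have mYY : measurable_fun setT
    (fun w => (Y (fourier (k i)) w - theta f (k i)) * (Y (fourier (k j)) w - theta f (k j))).
  by apply: measurable_funM; exact: measurable_funB.
have {C} C : (\int[P]_w ((Y (fourier (k i)) w - theta f (k i)) *
    (Y (fourier (k j)) w - theta f (k j)))%:E = (n%:R^-1 * (i == j)%:R)%:E)%E.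
  by rewrite -C unlock.
under eq_integral do rewrite /xi mulrACA -expr2 sqr_sqrtr// EFinM.
rewrite integralZl//; last exact: finite_integral_integrable C.
by rewrite C -EFinM mulrA mulfV ?mul1r// pnatr_eq0 -lt0n.
Qed.

(** Joint Gaussianity of [Y] enters here: the form is [X - e] for a linear combination [X] of
    observations with mean [e], and by orthonormality of the basis its variance is the sum of the
    [b i ^+ 2]. *)
Lemma mgf_xi (b : nat -> R) :
  (\int[P]_w (expR (\sum_(i < N) b i * xi i w))%:E
     <= (expR (\sum_(i < N) b i ^+ 2 / 2))%:E)%E.
Proof.
have [gY EY CY] := wn.
pose a (i : 'I_N) := b i * Num.sqrt n%:R.
pose X w := \sum_(i < N) a i * Y (fourier (k i)) w.
pose e := \sum_(i < N) a i * theta f (k i).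
have XE w : X w - e = \sum_(i < N) b i * xi i w.
  by rewrite /X /e -sumrB; apply: eq_bigr => i _; rewrite /xi -mulrBr mulrA.
have mX : measurable_fun setT X.
  by apply: measurable_sum => i; exact: measurable_funM.
have gX : is_gaussian P X.
  by apply: (gY _ a (fun i => fourier (k i))) => i; exact: fourier_L2.
have iY i : P.-integrable setT (EFin \o (Y (fourier (k i)))).
  exact: finite_integral_integrable (integral_noise i).
have iaY (i : 'I_N) : P.-integrable setT (fun w => (a i)%:E * (Y (fourier (k i)) w)%:E)%E.
  exact: (integrableZl measurableT (a i) (iY i)).
have EX : (\int[P]_w (X w)%:E = e%:E)%E.
  under eq_integral do rewrite /X -sumEFin.
  rewrite integral_sum// /e -sumEFin; apply: eq_bigr => i _.
  by under eq_integral do rewrite EFinM; rewrite (integralZl measurableT (iY i)) integral_noise.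
have iX : P.-integrable setT (EFin \o X) by exact: finite_integral_integrable EX.
have V : (\int[P]_w ((X w - e) ^+ 2)%:E = (\sum_(i < N) b i ^+ 2)%:E)%E.
  have E2 w : (((X w - e) ^+ 2)%:E =
      \sum_(i < N) \sum_(j < N) (b i * b j)%:E * (xi i w * xi j w)%:E)%E.
    rewrite XE expr2 big_distrlr/= -sumEFin; apply: eq_bigr => i _.
    by rewrite -sumEFin; apply: eq_bigr => j _; rewrite -EFinM mulrACA.
  have mxx (i j : nat) : measurable_fun setT (fun w => xi i w * xi j w).
    by apply: measurable_funM; exact: measurable_xi.
  have ixx (i j : 'I_N) : P.-integrable setT (fun w => (b i * b j)%:E * (xi i w * xi j w)%:E)%E.
    apply: integrableZl => //.
    exact: finite_integral_integrable (integral_xi2 (ltn_ord i) (ltn_ord j)).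
  under eq_integral do rewrite E2.
  rewrite integral_sum//; last by move=> i; exact: integrable_sum.
  rewrite -sumEFin; apply: eq_bigr => i _; rewrite integral_sum//.
  rewrite (bigD1 i)//= big1 => [|j ji]; rewrite integralZl//; last 3 first.
  - exact: finite_integral_integrable (integral_xi2 (ltn_ord i) (ltn_ord i)).
  - by rewrite integral_xi2// val_eqE eq_sym (negbTE ji) mule0.
  - exact: finite_integral_integrable (integral_xi2 (ltn_ord i) (ltn_ord j)).
  by rewrite integral_xi2// eqxx mule1 adde0 expr2.
under eq_integral do rewrite -XE.
by have := gaussian_mgf mX gX iX EX V; rewrite mulr_suml.
Qed.

Let S w := \sum_(i < N) (xi i w ^+ 2 - 1).

Lemma integral_chi2_xi : (\int[P]_w (S w)%:E = 0)%E.
Proof.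
have xi2 (i : 'I_N) : (\int[P]_w (xi i w ^+ 2)%:E = 1%E)%E.
  by under eq_integral do rewrite expr2; rewrite integral_xi2// eqxx.
have ixi2 (i : 'I_N) : P.-integrable setT (EFin \o (fun w => xi i w ^+ 2)).
  apply: finite_integral_integrable (xi2 i).
  by apply: measurable_funX; exact: measurable_xi.
have icst : P.-integrable setT (EFin \o cst 1) by exact: finite_measure_integrable_cst.
under eq_integral do rewrite /S -sumEFin.
rewrite integral_sum//.
  rewrite big1// => i _; under eq_integral do rewrite EFinB.
  rewrite (integralB_EFin measurableT (ixi2 i) icst) [X in (X - _)%E]xi2.
  by have := expectation_cst P 1; rewrite unlock => ->; rewrite subee.
move=> i; have := integrableB measurableT (ixi2 i) icst.
by apply: eq_integrable.
Qed.

Let Q w := \sum_(i < N) (Y (fourier (k i)) w ^+ 2 - n%:R^-1).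

Lemma sum_sqr_noiseE w : Q w = \sum_(i < N) theta f (k i) ^+ 2 +
  2 / Num.sqrt n%:R * (\sum_(i < N) theta f (k i) * xi i w) + n%:R^-1 * S w.
Proof.
have nR : 0 < n%:R :> R by rewrite ltr0n.
have s0 : Num.sqrt n%:R != 0 :> R by rewrite gt_eqF// sqrtr_gt0.
have s2 : Num.sqrt n%:R ^+ 2 = n%:R :> R by rewrite sqr_sqrtr// ltW.
rewrite /Q /S !mulr_sumr -!big_split; apply: eq_bigr => i _ /=.
have ni : n%:R^-1 = Num.sqrt n%:R ^- 2 :> R by rewrite s2.
rewrite ni /xi; move: (Num.sqrt _) s0 => s s0.
by field.
Qed.

Lemma Qhat_null_tail (a lam : R) : (forall i, (i < N)%N -> theta f (k i) = 0) ->
  0 <= a -> a <= 1 / 4 ->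
  (P [set w | (lam <= Q w)%R] <= (expR (4 * a ^+ 2 * N%:R - a * (n%:R * lam)))%:E)%E.
Proof.
move=> th0 a0 a4; have nR : 0 < n%:R :> R by rewrite ltr0n.
rewrite (_ : [set w | _] = [set w | (n%:R * lam <= S w)%R]).
  exact: (chi2_upper_tail measurable_xi mgf_xi).
apply/seteqP; split => w /=; rewrite sum_sqr_noiseE big1 ?add0r; try by move=> i _; rewrite th0// expr0n.
  rewrite big1 ?mulr0 ?add0r; last by move=> i _; rewrite th0// mul0r.
  by rewrite ler_pdivlMl.
by rewrite big1 ?mulr0 ?add0r ?ler_pdivlMl// => i _; rewrite th0// mul0r.
Qed.

(** Since the energy is at least [2 lam], [Q < lam] forces the linear term or the centred quadratic
    term down to [- lam / 2]. The first is handled by the exponential Markov bound with multiplier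
    1; the second by [chi2_lower_tail] at [t = n lam / 2], where [8 <= n lam] provides [t >= 4]. *)
Lemma Qhat_signal_tail (lam : R) : 8 <= n%:R * lam ->
  2 * lam <= \sum_(i < N) theta f (k i) ^+ 2 ->
  (P [set w | (Q w < lam)%R] <=
   (expR (\sum_(i < N) theta f (k i) ^+ 2 / 2 - Num.sqrt n%:R * lam / 4) +
    expR 1 * (expR (4 * (n%:R * lam / 2)^-1 ^+ 2 * N%:R) - 1))%:E)%E.
Proof.
move=> nl Vl; have nR : 0 < n%:R :> R by rewrite ltr0n.
pose A := [set w | Num.sqrt n%:R * lam / 4 <= \sum_(i < N) (- theta f (k i)) * xi i w].
pose B := [set w | S w <= - (n%:R * lam / 2)].
have mlin (b : nat -> R) : measurable_fun setT (fun w => \sum_(i < N) b i * xi i w).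
  by apply: measurable_sum => i; apply: measurable_funM => //; exact: measurable_xi.
have mS : measurable_fun setT S by exact: (measurable_chi2 N measurable_xi).
have mQ : measurable_fun setT Q.
  apply: measurable_sum => i; apply: measurable_funB => //; exact: measurable_funX.
have mA : measurable A.
  rewrite -[X in measurable X]setTI; apply: measurable_fun_ler => //.
  exact: (mlin (fun i => - theta f (k i))).
have mB : measurable B by rewrite -[X in measurable X]setTI; exact: measurable_fun_ler.
apply: (@le_trans _ _ (P (A `|` B))).
  apply: le_measure; rewrite ?inE.
  - rewrite -[X in measurable X]setTI; exact: measurable_fun_ltr.
  - exact: measurableU.
  move=> w /= Qw; apply: contrapT => /not_orP[/negP + /negP]; rewrite -!ltNge => Aw Bw.
  move: Qw; apply/negP; rewrite -leNgt sum_sqr_noiseE.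
  set q := Num.sqrt n%:R in Aw *; have q0 : 0 < q by rewrite sqrtr_gt0.
  have E : \sum_(i < N) - theta f (k i) * xi i w = - \sum_(i < N) theta f (k i) * xi i w.
    by rewrite -sumrN; apply: eq_bigr => i _; rewrite mulNr.
  rewrite E in Aw; move: Vl Aw Bw; set V := \sum_(i < N) _; set Z := \sum_(i < N) _.
  move=> Vl Aw Bw.
  have : - (lam / 2) <= 2 / q * Z.
    rewrite mulrAC ler_pdivlMr// mulNr; lra.
  have : - (lam / 2) <= n%:R^-1 * S w.
    rewrite ler_pdivlMl// mulrN; lra.
  by lra.
apply: le_trans (measureU2 _ mA mB) _.
rewrite EFinD; apply: leeD.
  rewrite expRD; apply: markov_exp; first exact: (mlin (fun i => - theta f (k i))).
  by have := mgf_xi (fun i => - theta f (k i)); under eq_bigr do rewrite sqrrN.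
apply: (chi2_lower_tail measurable_xi mgf_xi); first lra.
- exact: finite_integral_integrable integral_chi2_xi.
- exact: integral_chi2_xi.
Qed.
End white_noise.

(** * Lattice points and truncated energy *)

Section lattice_points.
Context {R : realType}.

Lemma ler_sum_uniq_sub (T : eqType) (s s' : seq T) (F : T -> R) : uniq s -> uniq s' ->
  {subset s <= s'} -> (forall x, 0 <= F x) -> \sum_(x <- s) F x <= \sum_(x <- s') F x.
Proof.
move=> us us' ss' F0.
have /(perm_big _) -> : perm_eq s [seq x <- s' | x \in s].
  apply: uniq_perm => // [|x]; first exact: filter_uniq.
  by rewrite mem_filter; apply/idP/andP => [xs|[]//]; split => //; exact: ss'.
by rewrite big_filter big_mkcond; apply: ler_sum => x _; case: ifP.
Qed.

(* Enumerates the integers of absolute value at most [M] as [0, .., M, -1, .., -M]. *)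
Definition dec_int (M i : nat) : int := if (i <= M)%N then Posz i else Negz (i - M.+1).

Definition enc_int (M : nat) (x : int) : nat :=
  match x with Posz i => i | Negz i => M.+1 + i end.

Lemma enc_intK (M : nat) (x : int) : (absz x <= M)%N -> dec_int M (enc_int M x) = x.
Proof.
case: x => i /= iM; rewrite /dec_int; first by rewrite iM.
by rewrite leqNgt ltnS leq_addr /= addKn.
Qed.

Lemma enc_int_lt (M : nat) (x : int) : (absz x <= M)%N -> (enc_int M x < (M + M).+1)%N.
Proof. by case: x => i /= iM; rewrite ?ltnS ?ltn_add2l//; lia. Qed.

Lemma dec_int_inj M : injective (dec_int M).
Proof.
move=> i j; rewrite /dec_int; case: leqP => iM; case: leqP => jM //; first by case.
by case=> /eqP; rewrite eqn_sub2rE// => /eqP.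
Qed.

Variable z : R.
Hypothesis z01 : 0 < z < 1.
Let z0 : 0 < z. Proof. by case/andP: z01. Qed.
Let z1 : z < 1. Proof. by case/andP: z01. Qed.

Let G (x : int) : R := z ^+ (absz x ^ 2)%N.

Let G0 x : 0 <= G x. Proof. by rewrite exprn_ge0// ltW. Qed.

Let G_le (x : int) : G x <= z ^+ absz x.
Proof.
by rewrite /G ler_wiXn2l ?ltW//; case: (absz x) => // a; rewrite expnS leq_pmulr.
Qed.

Let geo n : \sum_(i < n) z ^+ i <= (1 - z)^-1.
Proof.
have zz : 0 < 1 - z by rewrite subr_gt0.
rewrite -[leRHS]div1r ler_pdivlMr// mulrC.
by rewrite -opprB mulNr -subrX1 opprB gerBl exprn_ge0// ltW.
Qed.

Let sum_dec_le M : \sum_(i < (M + M).+1) G (dec_int M i) <= 2 / (1 - z).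
Proof.
rewrite mulr2n mulrDl mul1r (_ : (M + M).+1 = M.+1 + M)%N// big_split_ord /=.
apply: lerD; apply: le_trans (geo _); apply: ler_sum => i _; rewrite /dec_int.
- by rewrite -ltnS ltn_ord (le_trans (G_le _)).
- rewrite leqNgt ltnS leq_addr /= addKn (le_trans (G_le _))//=.
  by rewrite ler_wiXn2l// ltW.
Qed.

Let set_le_dec (X : set int) : finite_set X -> exists M : nat,
  {subset finmap.enum_fset (fset_set X) <= map (dec_int M) (iota 0 (M + M).+1)}.
Proof.
move=> finX; pose M := \max_(x <- finmap.enum_fset (fset_set X)) absz x.
exists M => x xX; have xM : (absz x <= M)%N by exact: (leq_bigmax_seq (F := absz)).
apply/mapP; exists (enc_int M x); first by rewrite mem_iota enc_int_lt.
by rewrite enc_intK.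
Qed.

Let uniq_dec M : uniq (map (dec_int M) (iota 0 (M + M).+1)).
Proof.
by rewrite map_inj_uniq ?iota_uniq//; exact: dec_int_inj.
Qed.

(** [jacobi_theta] applies [fine], which would send an infinite sum to 0, so finiteness comes first:
    [z^(r^2) <= z^|r|] bounds the sum by two geometric series. *)
Lemma jacobi_theta_fin : (\esum_(r in [set: int]) (G r)%:E <= (2 / (1 - z))%:E)%E.
Proof.
apply: ge_ereal_sup => _ [X [finX _]] <-.
rewrite fsbig_finite//= sumEFin lee_fin.
have [M XM] := set_le_dec finX.
apply: le_trans (ler_sum_uniq_sub (finmap.fset_uniq _) (uniq_dec M) XM G0) _.
by rewrite big_map -[iota _ _]/(index_iota 0 (M + M).+1) big_mkord; exact: sum_dec_le.
Qed.

Lemma jacobi_theta_ge M : \sum_(i < (M + M).+1) G (dec_int M i) <= jacobi_theta z.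
Proof.
rewrite -lee_fin /jacobi_theta fineK; last first.
  rewrite ge0_fin_numE; first exact: le_lt_trans jacobi_theta_fin (ltry _).
  by apply: esum_ge0 => x _; exact: G0.
apply: esum_ge; exists [set` (map (dec_int M) (iota 0 (M + M).+1))].
  by split => //; exact: finite_seq.
by rewrite -fsbig_seq// big_map sumEFin -[iota _ _]/(index_iota 0 (M + M).+1) big_mkord.
Qed.

Lemma jacobi_theta_ge1 : 1 <= jacobi_theta z.
Proof.
apply: le_trans (jacobi_theta_ge 0); rewrite big_ord_recl big_ord0 addr0.
by rewrite /G /dec_int /= expr0.
Qed.

Definition dec_freq d M (t : {ffun 'I_d -> 'I_(M + M).+1}) : freq d :=
  [ffun i => dec_int M (t i)].

Lemma dec_freq_inj d M : injective (@dec_freq d M).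
Proof.
move=> s t /ffunP st; apply/ffunP => i; apply/val_inj/(@dec_int_inj M).
by have := st i; rewrite !ffunE.
Qed.

Lemma sum_sqr_S_freq d (j : 'I_d) (m : R) (I : {set 'I_d}) (k : freq d) (A : {pred 'I_d}) :
  S_freq j m I k -> \sum_(i in A) (k i)%:~R ^+ 2 <= m ^+ 2.
Proof.
case=> km _; have S0 : 0 <= \sum_i (k i)%:~R ^+ 2 :> R by apply: sumr_ge0 => i _; exact: sqr_ge0.
apply: (@le_trans _ _ (\sum_i (k i)%:~R ^+ 2)).
  by rewrite big_mkcond; apply: ler_sum => i _; case: ifP => // _; exact: sqr_ge0.
rewrite -[leLHS]sqr_sqrtr// ler_pXn2r// nnegrE ?sqrtr_ge0//.
exact: le_trans (sqrtr_ge0 _) km.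
Qed.

(** [ord0] decodes to 0, so functions equal to [ord0] outside [I] decode to frequencies supported in
    [I]. Coding by functions lets [big_distr_big] factor the sum in [card_S_freq]. *)
Lemma S_freq_dec d (j : 'I_d) (m : R) (I : {set 'I_d}) M : m <= M%:R ->
  {subset S_freq j m I <=
    map (@dec_freq d M) (enum (pffun_on (ord0 : 'I_(M + M).+1) (mem I) predT))}.
Proof.
move=> mM k; rewrite inE => kS; have kM i : (absz (k i) <= M)%N.
  have := sum_sqr_S_freq (pred1 i) kS; rewrite big_pred1_eq => kim.
  have m0 : 0 <= m by case: kS => + _; exact: le_trans (sqrtr_ge0 _).
  rewrite -(ler_nat R) natr_absz intr_norm (le_trans _ mM)//.
  by rewrite -(ler_pXn2r (n := 2))// ?nnegrE// real_normK ?num_real.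
apply/mapP; exists [ffun i => Ordinal (enc_int_lt (kM i))]; last first.
  by apply/ffunP => i; rewrite !ffunE /= enc_intK.
rewrite mem_enum; apply/pffun_onP; split; last by move=> x _.
apply/fintype.subsetP => i; rewrite inE ffunE => ki.
case: kS => _ [_ /fintype.subsetP]; apply; rewrite inE; apply: contraNneq ki => ki0.
by apply/eqP/val_inj; rewrite /= ki0.
Qed.

Lemma finite_S_freq d (j : 'I_d) (m : R) (I : {set 'I_d}) : finite_set (S_freq j m I).
Proof.
have mM : m <= (Num.bound `|m|)%:R by exact: le_trans (ler_norm _) (ltW (archi_boundP (normr_ge0 _))).
apply: sub_finite_set (finite_seq (map (@dec_freq d _) (enum (pffun_on ord0 (mem I) predT)))).
by move=> k kS; apply: (S_freq_dec mM); rewrite inE; exact: kS.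
Qed.

(** Chernoff's argument for counting: give [k] the weight [z^(|k|^2)]. Each counted [k] weighs at
    least [z^(m^2) = expR (m ^+ 2 * ln z)], while, the weight being a product over coordinates, any
    box of lattice points supported in [I] weighs at most [h(z)^#|I|]. *)
Lemma card_S_freq d (j : 'I_d) (m : R) (I : {set 'I_d}) :
  (size (finmap.enum_fset (fset_set (S_freq j m I))))%:R * expR (m ^+ 2 * ln z) <= jacobi_theta z ^+ #|I|.
Proof.
set s := finmap.enum_fset _; set M := Num.bound `|m|.
have mM : m <= M%:R by exact: le_trans (ler_norm _) (ltW (archi_boundP (normr_ge0 _))).
pose F (k : freq d) := \prod_(i in I) G (k i).
apply: (@le_trans _ _ (\sum_(k <- s) F k)).
  rewrite -sum1_size natr_sum mulr_suml big_seq [leRHS]big_seq.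
  apply: ler_sum => k; rewrite in_fset_set ?inE => [kS|]; last exact: finite_S_freq.
  have zE : z = expR (ln z) by rewrite lnK.
  rewrite mul1r /F /G prodrXr [in leRHS]zE -expRM_natl ler_expR natr_sum.
  apply: ler_wnM2r; first by rewrite ln_le0// ltW.
  apply: le_trans (sum_sqr_S_freq (mem I) kS).
  by apply: ler_sum => i _; rewrite natrX natr_absz intr_norm real_normK// num_real.
have us : uniq (map (@dec_freq d M) (enum (pffun_on (ord0 : 'I_(M + M).+1) (mem I) predT))).
  by rewrite map_inj_uniq ?enum_uniq//; exact: dec_freq_inj.
have ss : {subset s <= map (@dec_freq d M) (enum (pffun_on (ord0 : 'I_(M + M).+1) (mem I) predT))}.
  by move=> k; rewrite in_fset_set; [exact: (S_freq_dec mM)|exact: finite_S_freq].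
apply: le_trans (ler_sum_uniq_sub (finmap.fset_uniq _) us ss _) _.
  by move=> k; apply: prodr_ge0 => i _.
rewrite big_map big_enum /= /F.
under eq_bigr => t _ do under eq_bigr do rewrite ffunE.
rewrite -(big_distr_big ord0 (mem I) predT (fun _ (r : 'I_(M + M).+1) => G (dec_int M r))).
rewrite prodr_const; apply: lerXn2r; rewrite ?nnegrE.
- by apply: sumr_ge0.
- exact: le_trans ler01 jacobi_theta_ge1.
- exact: jacobi_theta_ge.
Qed.
End lattice_points.

(** * Energy retained by the truncation *)

Section frequencies.
Context {R : realType}.

Lemma S_freq_neq0 d (j : 'I_d) (m : R) (I : {set 'I_d}) (k : freq d) :
  S_freq j m I k -> k j != 0.
Proof. by case=> _ [/fintype.subsetP/(_ j)]; rewrite !inE eqxx => /(_ isT). Qed.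

Lemma S_freq_enum d (j : 'I_d) (m : R) (I : {set 'I_d}) :
  let N := size (finmap.enum_fset (fset_set (S_freq j m I))) in
  exists k : nat -> freq d, [/\ forall i, k i != 0,
    forall i i', (i < N)%N -> (i' < N)%N -> k i = k i' -> i = i',
    forall i, (i < N)%N -> S_freq j m I (k i) &
    forall F : freq d -> R, \sum_(k \in S_freq j m I) F k = \sum_(i < N) F (k i)].
Proof.
(* The default [k1] is a nonzero frequency, so that [k i != 0] holds beyond the end of the list as
   well. *)
move=> N; pose s := finmap.enum_fset (fset_set (S_freq j m I)); pose k1 : freq d := [ffun => 1].
have finS := @finite_S_freq R d j m I.
have kS i : (i < N)%N -> S_freq j m I (nth k1 s i).
  by move=> iN; have := mem_nth k1 iN; rewrite in_fset_set// inE.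
exists (nth k1 s); split => //.
- move=> i; have [iN|Ni] := ltnP i N.
    by apply: contraTneq (S_freq_neq0 (kS i iN)) => ->; rewrite ffunE.
  by rewrite nth_default//; apply/eqP => /ffunP/(_ j); rewrite !ffunE.
- by move=> i i' iN i'N /eqP; rewrite nth_uniq ?finmap.fset_uniq// => /eqP.
- by move=> F; rewrite fsbig_finite//= (big_nth k1) big_mkord.
Qed.

(** A frequency with [k j != 0] outside [S_freq j m J] either has support leaving [J], and its
    coefficient is 0, or has norm above [m], and then [1 <= m^-2 * \sum_(i in J) k_i^2]. Summed over
    [k], the latter costs at most [m^-2 L] for each of the [#|J|] coordinates. *)
Lemma signal_ge (kappa L : R) (s d : nat) (f : d.-tuple R -> R) (J : {set 'I_d})
    (j : 'I_d) (m : R) : L2_cube f -> C1 kappa L s f J -> j \in J -> 0 < m ->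
  kappa <= \sum_(k \in S_freq j m J) theta f k ^+ 2 + m ^- 2 * (#|J|%:R * L).
Proof.
move=> f2 [fL Js [fbar fJ] fk] jJ m0.
have mi0 : 0 <= m ^- 2 by rewrite invr_ge0 exprn_ge0// ltW.
 rewrite -lee_fin; apply: le_trans (fk j jJ) _.
apply: ge_ereal_sup => _ [X [finX Xj]] <-.
rewrite fsumEFin// lee_fin.
have finS := @finite_S_freq R d j m J.
have sumL (i : 'I_d) : \sum_(k \in X) (k i)%:~R ^+ 2 * theta f k ^+ 2 <= L.
  rewrite -lee_fin -fsumEFin//; apply: le_trans (fL i).
  by apply: ereal_sup_ubound; exists X.
rewrite fsbig_finite//=.
have -> : \sum_(k \in S_freq j m J) theta f k ^+ 2 =
    \sum_(k <- finmap.enum_fset (fset_set (S_freq j m J))) theta f k ^+ 2 by rewrite fsbig_finite.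
apply: (@le_trans _ _ (\sum_(k <- finmap.enum_fset (fset_set X)) ((if k \in S_freq j m J then theta f k ^+ 2 else 0) +
    m ^- 2 * (\sum_(i in J) (k i)%:~R ^+ 2 * theta f k ^+ 2)))).
  rewrite big_seq [leRHS]big_seq; apply: ler_sum => k; rewrite in_fset_set// inE => kX.
  have pos : 0 <= m ^- 2 * (\sum_(i in J) (k i)%:~R ^+ 2 * theta f k ^+ 2).
    by apply: mulr_ge0 => //; apply: sumr_ge0 => i _; apply: mulr_ge0; exact: sqr_ge0.
  case: ifPn => [_|kS]; first by rewrite lerDl.
  rewrite add0r; have [[i [iJ ki]]|kJ] := pselect (exists i, i \notin J /\ k i != 0).
    by apply: le_trans pos; rewrite (theta_eq0 f2 fJ ki iJ) expr0n.
  have kJ' i : k i != 0 -> i \in J.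
    by move=> ki; apply/negPn/negP => iJ; apply: kJ; exists i.
  have km : m < Num.sqrt (\sum_(i < d) (k i)%:~R ^+ 2).
    rewrite ltNge; apply: contraNN kS => km; rewrite inE; split => //; split.
      by apply/fintype.subsetP => i; rewrite !inE => /eqP ->; exact: Xj.
    by apply/fintype.subsetP => i; rewrite inE; exact: kJ'.
  rewrite -mulr_suml mulrA ler_peMl ?sqr_ge0// ler_pdivlMl ?exprn_gt0// mulr1.
  have -> : \sum_(i in J) (k i)%:~R ^+ 2 = \sum_(i < d) (k i)%:~R ^+ 2 :> R.
    rewrite [LHS]big_mkcond; apply: eq_bigr => i _; case: ifPn => // iJ.
    have [->|/kJ'] := eqVneq (k i) 0; first by rewrite expr0n.
    by rewrite (negbTE iJ).
  rewrite -[leRHS]sqr_sqrtr; first by rewrite ler_pXn2r ?nnegrE ?sqrtr_ge0// ltW.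
  by apply: sumr_ge0 => i _; exact: sqr_ge0.
rewrite big_split /=; apply: lerD.
  rewrite -big_mkcond -big_filter; apply: ler_sum_uniq_sub.
  - by rewrite filter_uniq// finmap.fset_uniq.
  - exact: finmap.fset_uniq.
  - by move=> k; rewrite mem_filter => /andP[kS _]; rewrite in_fset_set.
  - by move=> k; exact: sqr_ge0.
rewrite -mulr_sumr; apply: ler_wpM2l => //.
rewrite exchange_big /= mulr_natl -sumr_const; apply: ler_sum => i _.
by have := sumL i; rewrite fsbig_finite.
Qed.
End frequencies.

(** * Error bound at fixed sample size *)

Section union_bound.
Context {R : realType}.

Lemma bigmaxe_geP (I : eqType) (r : seq I) (Q : pred I) (F : I -> \bar R) (x : R) :
  (x%:E <= \big[maxe/-oo]_(i <- r | Q i) F i)%E <->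
  exists i, [/\ i \in r, Q i & (x%:E <= F i)%E].
Proof.
elim: r => [|i r IH]; first by rewrite big_nil; split => // -[i []].
rewrite big_cons; split.
  case: ifPn => Qi; last first.
    by move=> /IH[l [lr Ql xl]]; exists l; rewrite inE lr orbT.
  rewrite le_max => /orP[xi|/IH[l [lr Ql xl]]]; first by exists i; rewrite inE eqxx.
  by exists l; rewrite inE lr orbT.
move=> [l []]; rewrite inE => /orP[/eqP -> ->|lr Ql xl]; first by rewrite le_max => ->.
have /IH xm : exists i, [/\ i \in r, Q i & (x%:E <= F i)%E] by exists l.
by case: ifP => // _; rewrite le_max xm orbT.
Qed.

Lemma Jhat_in (n d s : nat) (m lam : nat -> R) (y : (d.-tuple R -> R) -> R) (j : 'I_d) :
  (forall l, 0 < lam l) ->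
  (j \in Jhat n s m lam y) <->
  exists I : {set 'I_d}, (0 < #|I| <= s)%N /\ lam #|I| <= Qhat n y j (m #|I|) I.
Proof.
move=> lam0; rewrite inE; split.
  move=> /bigmaxe_geP[l []]; rewrite mem_index_iota ltnS => ls _.
  rewrite lee_pdivlMl// mule1 => /bigmaxe_geP[I [_ /eqP IE]]; rewrite lee_fin => Q.
  by exists I; rewrite IE.
move=> [I [Is Q]]; apply/bigmaxe_geP; exists #|I|; split => //.
  by rewrite mem_index_iota ltnS.
rewrite lee_pdivlMl// mule1; by apply/bigmaxe_geP; exists I.
Qed.

(** A nonempty set with at most [s] elements is the image of a map from ['I_s]: list its elements
    and pad with one of them. *)
Lemma card_small_sets (d s : nat) :
  (#|[set I : {set 'I_d} | (0 < #|I| <= s)%N]%SET| <= d ^ s)%N.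
Proof.
have -> : (d ^ s = #|{: {ffun 'I_s -> 'I_d}}|)%N by rewrite card_ffun !card_ord.
apply: leq_trans (leq_imset_card (fun t : {ffun 'I_s -> 'I_d} => [set t i | i : 'I_s]%SET) _).

apply: subset_leq_card; apply/fintype.subsetP => I; rewrite inE => /andP[].
rewrite card_gt0 => /set0Pn[x0 x0I] Is.
apply/imsetP; exists [ffun i : 'I_s => nth x0 (enum I) i]; rewrite ?inE//.
apply/setP => x; apply/idP/imsetP => [xI|[i _ ->]].
  have xs : (index x (enum I) < s)%N.
    by apply: leq_trans Is; rewrite cardE index_mem mem_enum.
  by exists (Ordinal xs) => //; rewrite ffunE /= nth_index// mem_enum.
rewrite ffunE; have [iI|Ii] := ltnP i (size (enum I)); last by rewrite nth_default.
by rewrite -mem_enum mem_nth.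
Qed.

Lemma measure_bigsetU_le d (T : measurableType d) (P : probability T R) (I : eqType)
    (r : seq I) (Q : pred I) (A : I -> set T) : (forall i, measurable (A i)) ->
  measurable [set w | exists i, [/\ i \in r, Q i & A i w]] /\
  (P [set w | exists i, [/\ i \in r, Q i & A i w]] <= \sum_(i <- r | Q i) P (A i))%E.
Proof.
move=> mA; elim: r => [|i r [IHm IH]].
  rewrite (_ : [set w | _] = set0); first by rewrite big_nil measure0.
  by apply/seteqP; split => // w /= [i []].
set B := [set w | _] in IHm IH; rewrite big_cons.
rewrite (_ : [set w | _] = (if Q i then A i else set0) `|` B); last first.
  apply/seteqP; split => w /=.
    move=> [l []]; rewrite inE => /orP[/eqP -> -> Aw|lr Ql Aw]; first by left.
    by right; exists l.
  case=> [|[l [lr Ql Aw]]]; last by exists l; rewrite inE lr orbT.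
  by case: ifPn => // Qi Aw; exists i; rewrite inE eqxx.
case: ifPn => Qi; last by rewrite set0U.
split; first exact: measurableU.
by apply: le_trans (measureU2 _ _ _) _ => //; exact: leeD.
Qed.
End union_bound.

(** * Union bound over false positives and missed coordinates *)

Section error_bound.
Context {R : realType}.
Variables (n d s : nat) (kappa L : R) (f : d.-tuple R -> R) (J : {set 'I_d}).
Variables (disp : measure_display) (Omega : measurableType disp) (P : probability Omega R).
Variable Y : (d.-tuple R -> R) -> {RV P >-> R}.
Hypothesis n0 : (0 < n)%N.
Hypothesis f2 : L2_cube f.
Hypothesis C1f : C1 kappa L s f J.
Hypothesis wn : white_noise n f Y.
Variables (m : nat -> R) (lam B a : R).
Hypothesis lam0 : 0 < lam.
Hypothesis B0 : 0 <= B.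
Hypothesis cardB : forall (j : 'I_d) (I : {set 'I_d}), (0 < #|I| <= s)%N ->
  (size (finmap.enum_fset (fset_set (S_freq j (m #|I|) I))))%:R <= B.
Hypothesis a0 : 0 <= a.
Hypothesis a4 : a <= 1 / 4.
Hypothesis nlam : 8 <= n%:R * lam.
Hypothesis signal : forall j, j \in J ->
  2 * lam <= \sum_(k \in S_freq j (m #|J|) J) theta f k ^+ 2.

Let Q (j : 'I_d) (I : {set 'I_d}) (w : Omega) : R := Qhat n (fun phi => Y phi w) j (m #|I|) I.

Lemma measurable_Qhat (j : 'I_d) (I : {set 'I_d}) : measurable_fun setT (Q j I).
Proof.
have [k [_ _ _ E]] := @S_freq_enum R d j (m #|I|) I.
rewrite /Q /Qhat; under eq_fun do rewrite E.
by apply: measurable_sum => i; apply: measurable_funB => //; exact: measurable_funX.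
Qed.

Lemma Qhat_false_positive (j : 'I_d) (I : {set 'I_d}) : j \notin J -> (0 < #|I| <= s)%N ->
  (P [set w | (lam <= Q j I w)%R] <= (expR (4 * a ^+ 2 * B - a * (n%:R * lam)))%:E)%E.
Proof.
move=> jJ Is; have [k [k0 kinj kS E]] := @S_freq_enum R d j (m #|I|) I.
rewrite /Q /Qhat (_ : [set w | _] = [set w | (lam <= \sum_(i < size
  (finmap.enum_fset (fset_set (S_freq j (m #|I|) I)))) (Y (fourier (k i)) w ^+ 2 - n%:R^-1))%R]);
  last by apply/seteqP; split => w /=; rewrite E.
have [_ _ [fbar fJ] _] := C1f.
apply: le_trans (Qhat_null_tail n0 wn k0 kinj lam _ a0 a4) _.
  by move=> i iN; apply: (theta_eq0 f2 fJ (S_freq_neq0 (kS i iN)) jJ).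
rewrite lee_fin ler_expR lerD2r ler_wpM2l ?mulr_ge0 ?sqr_ge0//.
exact: cardB.
Qed.

Lemma Qhat_false_negative j : j \in J ->
  (P [set w | (Q j J w < lam)%R] <=
   (expR (L / 2 - Num.sqrt n%:R * lam / 4) +
    expR 1 * (expR (4 * (n%:R * lam / 2)^-1 ^+ 2 * B) - 1))%:E)%E.
Proof.
move=> jJ; have [k [k0 kinj kS E]] := @S_freq_enum R d j (m #|J|) J.
have sig := signal jJ; rewrite E in sig.
rewrite /Q /Qhat (_ : [set w | _] = [set w | (\sum_(i < size
  (finmap.enum_fset (fset_set (S_freq j (m #|J|) J)))) (Y (fourier (k i)) w ^+ 2 - n%:R^-1) < lam)%R]);
  last by apply/seteqP; split => w /=; rewrite E.
apply: le_trans (Qhat_signal_tail n0 wn k0 kinj nlam sig) _.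
have [fL Js _ _] := C1f.
(* Every [k] in this index set has [k j != 0], so [k_j^2 >= 1] and the smoothness bound in direction
   [j] also bounds the energy by [L]. *)
have thL : \sum_(i < size (finmap.enum_fset (fset_set (S_freq j (m #|J|) J)))) theta f (k i) ^+ 2 <= L.
  rewrite -(E (fun k => theta f k ^+ 2)) -lee_fin; apply: le_trans (fL j).
  apply: esum_ge; exists (S_freq j (m #|J|) J); first by split => //; exact: finite_S_freq.
  rewrite -fsumEFin; last exact: finite_S_freq.
  apply: lee_fsum; first exact: finite_S_freq.
  move=> k' k'S; rewrite lee_fin ler_peMl ?sqr_ge0//.
  by rewrite -rmorphXn /= ler1z -gtz0_ge1 exprn_even_gt0//= (S_freq_neq0 k'S).
rewrite lee_fin; apply: lerD.
  by rewrite ler_expR lerD2r -mulr_suml ler_pM2r// invr_gt0.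
rewrite ler_pM2l ?expR_gt0// lerD2r ler_expR; apply: ler_wpM2l.
  by rewrite mulr_ge0// sqr_ge0.
by apply: cardB; rewrite Js card_gt0 andbT; apply/set0Pn; exists j.
Qed.

(** For [j] in [J], a miss implies that the single statistic with [I = J] stays below [lam], and
    there are at most [s] such [j]. For [j] outside [J], each of the at most [d^s] sets [I] may
    trigger an error, which over all [j] gives [d^(s + 1)]. *)
Lemma Jhat_error_bound :
  (P [set w | Jhat n s m (fun=> lam) (fun phi => Y phi w) <> J] <=
   (d%:R ^+ s.+1 * expR (4 * a ^+ 2 * B - a * (n%:R * lam)) +
    s%:R * (expR (L / 2 - Num.sqrt n%:R * lam / 4) +
    expR 1 * (expR (4 * (n%:R * lam / 2)^-1 ^+ 2 * B) - 1)))%:E)%E.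
Proof.
set pp := expR (4 * a ^+ 2 * B - _); set pn := (expR (L / 2 - _) + _).
pose A (j : 'I_d) (I : {set 'I_d}) := [set w | (lam <= Q j I w)%R].
have mA j I : measurable (A j I).
  rewrite -[X in measurable X]setTI; apply: measurable_fun_ler => //.
  exact: measurable_Qhat.
pose small (I : {set 'I_d}) := (0 < #|I| <= s)%N.
pose D (j : 'I_d) := [set w | exists I : {set 'I_d}, [/\ I \in index_enum {set 'I_d}, small I & A j I w]].
have [mD PD] : (forall j, measurable (D j)) /\
    forall j, (P (D j) <= \sum_(I | small I) P (A j I))%E.
  by split => j; have [] := measure_bigsetU_le P (index_enum {set 'I_d}) small (mA j).
have DE j w : D j w <-> j \in Jhat n s m (fun=> lam) (fun phi => Y phi w).
  split => [[I [_ sI AI]]|/Jhat_in]; first by apply/Jhat_in => //; exists I.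
  by move=> /(_ (fun=> lam0))[I [sI AI]]; exists I; rewrite mem_index_enum.
pose F j := if j \in J then ~` D j else D j.
have mF j : measurable (F j) by rewrite /F; case: ifP => // _; exact: measurableC.
have EF : [set w | Jhat n s m (fun=> lam) (fun phi => Y phi w) <> J] =
    [set w | exists j, [/\ j \in index_enum 'I_d, true & F j w]].
  apply/seteqP; split => w /=.
    move=> JJ; apply: contrapT => H; apply: JJ; apply/setP => j.
    have : ~ F j w by move=> Fj; apply: H; exists j; rewrite mem_index_enum.
    rewrite /F; case: ifPn => jJ.
      by move=> /contrapT /DE ->.
    by move=> ND; apply/negP => /DE.
  move=> [j [_ _]]; rewrite /F; case: ifPn => jJ Dj JJ.
    by apply: Dj; apply/DE; rewrite JJ.
  by move: jJ; rewrite -JJ => /negP; apply; apply/DE.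
rewrite EF; apply: le_trans (measure_bigsetU_le P (index_enum 'I_d) xpredT mF).2 _.
rewrite (bigID (mem J))/= EFinD [leLHS]addeC; apply: leeD.
  apply: (@le_trans _ _ (\sum_(j | j \notin J) (d%:R ^+ s * pp)%:E)%E).
    apply: lee_sum => j jJ; rewrite /F (negbTE jJ); apply: le_trans (PD j) _.
    apply: (@le_trans _ _ (\sum_(I | small I) pp%:E)%E).
      by apply: lee_sum => I sI; exact: Qhat_false_positive.
    rewrite sumEFin lee_fin sumr_const -[_ *+ _]mulr_natl ler_wpM2r ?expR_ge0//.
    by rewrite -natrX ler_nat; apply: leq_trans (card_small_sets d s); rewrite cardsE.
  rewrite sumEFin lee_fin sumr_const -[_ *+ _]mulr_natl exprS -mulrA ler_wpM2r//.
    by rewrite mulr_ge0 ?exprn_ge0 ?expR_ge0.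
  by rewrite ler_nat; apply: leq_trans (max_card _) _; rewrite card_ord.
have [_ Js _ _] := C1f.
have pn0 : 0 <= pn.
  apply: addr_ge0; first exact: expR_ge0.
  apply: mulr_ge0; first exact: expR_ge0.
  rewrite subr_ge0 -[leLHS]expR0 ler_expR; apply: mulr_ge0 => //.
  by apply: mulr_ge0 => //; exact: sqr_ge0.
apply: (@le_trans _ _ (\sum_(j in J) pn%:E)%E).
  apply: lee_sum => j jJ; rewrite /F jJ; apply: le_trans (Qhat_false_negative jJ).
  apply: le_measure; rewrite ?inE.
  - exact: measurableC.
  - rewrite -[X in measurable X]setTI; apply: measurable_fun_ltr => //.
    exact: measurable_Qhat.
  move=> w /= ND; rewrite ltNge; apply/negP => lQ; apply: ND; exists J.
  by rewrite mem_index_enum /small Js card_gt0 andbT; split => //; apply/set0Pn; exists j.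
rewrite sumEFin lee_fin sumr_const -[_ *+ _]mulr_natl ler_wpM2r// ler_nat.
exact: Js.
Qed.
End error_bound.

(** * Asymptotics *)

Section asymptotics.
Context {R : realType}.

Lemma poly_le_exp (eps M : R) (k : nat) : 0 < eps -> 0 <= M ->
  \forall x \near +oo, M * (1 + x) ^+ k <= expR (eps * x).
Proof.
move=> e0 M0; pose A := M * 2 ^+ k * (k.+1)`!%:R / eps ^+ k.+1.
have e1 : 0 < eps ^+ k.+1 by rewrite exprn_gt0.
have f0 : 0 < (k.+1)`!%:R :> R by rewrite ltr0n fact_gt0.
near=> x.
have x1 : 1 <= x by near: x; exact: nbhs_pinfty_ge.
have xA : A <= x by near: x; apply: nbhs_pinfty_ge; exact: num_real.
have x0 : 0 < x by exact: lt_le_trans x1.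
have ex0 : 0 <= eps * x by rewrite mulr_ge0// ltW.
apply: le_trans (expR_ge1Dxn k ex0); apply: (@le_trans _ _ (M * (2 * x) ^+ k)).
  by rewrite ler_wpM2l// lerXn2r// ?nnegrE; lra.
apply: (@le_trans _ _ ((eps * x) ^+ k.+1 / (k.+1)`!%:R)); last by rewrite lerDr.
have : A * eps ^+ k.+1 <= x * eps ^+ k.+1 by rewrite ler_pM2r.
rewrite /A divfK ?gt_eqF// => H.
rewrite ler_pdivlMr// !exprMn (exprSr x) mulrA mulrAC.
have -> : eps ^+ k.+1 * (x ^+ k * x) = x * eps ^+ k.+1 * x ^+ k by ring.
by rewrite ler_pM2r ?exprn_gt0.
Unshelve. all: by end_near. Qed.

Lemma expRN_le_inv (t : R) : 0 < t -> expR (- t) <= t^-1.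
Proof.
move=> t0; rewrite expRN lef_pV2 ?posrE ?expR_gt0//.
by apply: le_trans (expR_ge1Dx t); rewrite lerDr.
Qed.

Lemma expR_le_12 (y : R) : 0 <= y -> y <= 1 / 2 -> expR y - 1 <= 2 * y.
Proof.
move=> y0 y1; have := expR_ge1Dx (- y); rewrite expRN => H.
have e0 := expR_gt0 y; have : expR y * (1 - y) <= 1.
  by have := ler_wpM2l (ltW e0) H; rewrite mulfV ?gt_eqF.
by nra.
Qed.

(** [E] stands for [n^(eta/4)]. The union cost is at most [(c + 1) t E] and the constant [C / 4] at
    most [C / 4 * t E], against a gain of order [E^2 / t]; the lower bound on [E] leaves an exponent
    of at most [- t E <= - t]. *)
Lemma false_positive_rate (c C K x t E S D : R) : 0 <= c -> 0 <= C -> 0 < K ->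
  t = 1 + x -> 0 < x -> 1 <= E -> (c + 2 + C / 4) * 4 / K * t ^+ 2 <= E ->
  0 <= S -> S <= c * x -> 0 <= D -> D <= E ->
  expR ((S + 1) * D + (C / 4 - K / 4 * E ^+ 2 / t)) <= 1 / t.
Proof.
move=> c0 C0 K0 tE x0 E1 H S0 Sc D0 DE; have t0 : 0 < t by lra.
rewrite div1r; apply: le_trans (expRN_le_inv t0); rewrite ler_expR.
have H' : (c + 2 + C / 4) * t * E <= K / 4 * E ^+ 2 / t.
  rewrite ler_pdivlMr//.
  have -> : (c + 2 + C / 4) * t * E * t = K / 4 * ((c + 2 + C / 4) * 4 / K * t ^+ 2) * E.
    by field; rewrite gt_eqF.
  have -> : K / 4 * E ^+ 2 = K / 4 * E * E by ring.
  by rewrite ler_pM2r ?ler_pM2l// ?divr_gt0//; lra.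
have tEge : t <= t * E by rewrite ler_peMr// ltW.
have A1 : (S + 1) * D <= (c + 1) * t * E.
  apply: (@le_trans _ _ ((S + 1) * E)); first by rewrite ler_wpM2l//; lra.
  by apply: ler_wpM2r; [lra|rewrite tE; nra].
have A2 : C / 4 <= C / 4 * (t * E) by rewrite ler_peMr ?divr_ge0//; lra.
have : (c + 2 + C / 4) * t * E = (c + 1) * t * E + t * E + C / 4 * (t * E) by ring.
by lra.
Qed.

(** [F] stands for [sqrt n]; its lower bound makes the exponent at most [L / 2 - 2 t]. One factor
    [expR (- t) <= 1 / t] absorbs [S <= c t], the other gives the rate. *)
Lemma linear_tail_rate (c K L x t F S : R) : 0 <= c -> 0 < K -> t = 1 + x -> 0 < x ->
  8 / K * t ^+ 2 <= F -> 0 <= S -> S <= c * x ->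
  S * expR (L / 2 - F * (K / t) / 4) <= c * expR (L / 2) / t.
Proof.
move=> c0 K0 tE x0 H S0 Sc; have t0 : 0 < t by lra.
have St : S <= c * t by rewrite tE mulrDr mulr1; lra.
have H' : t + t <= F * (K / t) / 4.
  rewrite mulrA -mulrA -invfM ler_pdivlMr ?mulr_gt0//.
  have : 8 / K * t ^+ 2 * K <= F * K by rewrite ler_pM2r.
  by rewrite mulrAC divfK ?gt_eqF//; nra.
apply: (@le_trans _ _ (c * t * (expR (L / 2) * (t^-1 * t^-1)))); last first.
  by rewrite le_eqVlt; apply/orP; left; apply/eqP; field; rewrite gt_eqF.
apply: ler_pM; rewrite ?expR_ge0// expRD ler_pM2l ?expR_gt0//.
apply: (@le_trans _ _ (expR (- t) * expR (- t))); first by rewrite -expRD ler_expR; lra.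
by apply: ler_pM; rewrite ?expR_ge0// expRN_le_inv.
Qed.

(** With [F] for [n] and [E] for [n^eta], the inner exponent [y] is at most [1 / t^2]; linearizing
    [expR y - 1 <= 2 y] leaves a factor [1 / t] after multiplication by [S <= c t]. *)
Lemma chi2_tail_rate (c C K x t E F S : R) : 0 <= c -> 0 <= C -> 0 < K -> t = 1 + x -> 1 <= x ->
  0 < E -> 0 < F -> 16 * C / K ^+ 2 * t ^+ 4 <= E -> 0 <= S -> S <= c * x ->
  S * (expR 1 * (expR (4 * (F * (K / t) / 2)^-1 ^+ 2 * (C * (F ^+ 2 / E))) - 1))
    <= 2 * expR 1 * c / t.
Proof.
move=> c0 C0 K0 tE x1 E0 F0 H S0 Sc; have t0 : 0 < t by lra.
have St : S <= c * t by rewrite tE mulrDr mulr1; lra.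
have -> : 4 * (F * (K / t) / 2)^-1 ^+ 2 * (C * (F ^+ 2 / E)) = 16 * C / K ^+ 2 * t ^+ 2 / E.
  by field; rewrite !gt_eqF.
set y := _ / E.
have y0 : 0 <= y.
  by rewrite divr_ge0 ?mulr_ge0 ?invr_ge0 ?exprn_ge0// ltW.
have yt : y <= (t ^+ 2)^-1.
  rewrite /y ler_pdivrMr// ler_pdivlMl ?exprn_gt0//.
  by apply: le_trans H; rewrite le_eqVlt; apply/orP; left; apply/eqP; field; rewrite gt_eqF.
have y12 : y <= 1 / 2.
  apply: le_trans yt _; rewrite -div1r ler_pdivrMr ?exprn_gt0//; nra.
apply: (@le_trans _ _ (c * t * (expR 1 * (2 * (t ^+ 2)^-1)))); last first.
  by rewrite le_eqVlt; apply/orP; left; apply/eqP; field; rewrite gt_eqF.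
have y1 := expR_le_12 y0 y12.
apply: ler_pM => //.
  apply: mulr_ge0; first exact: expR_ge0.
  by rewrite subr_ge0 -[leLHS]expR0 ler_expR.
by rewrite ler_pM2l ?expR_gt0//; lra.
Qed.

(* Here [x] is [ln n], [C expR ((2 - eta) x)] bounds the number of frequencies,
   [K / (1 + x)] is the threshold and [S], [D] stand for the sparsity and [ln d]. *)
Lemma error_rate (c eta C K L : R) : 0 < c -> 0 < eta -> 0 < C -> 0 < K ->
  \forall x \near +oo, 8 <= expR x * (K / (1 + x)) /\
  forall S D B a : R, 0 <= S -> S <= c * x -> 0 <= D -> D <= expR (eta / 4 * x) ->
  B = C * expR ((2 - eta) * x) -> a = expR ((eta / 2 - 1) * x) / 4 ->
  expR ((S + 1) * D) * expR (4 * a ^+ 2 * B - a * (expR x * (K / (1 + x)))) +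
  S * (expR (L / 2 - expR (x / 2) * (K / (1 + x)) / 4) +
       expR 1 * (expR (4 * (expR x * (K / (1 + x)) / 2)^-1 ^+ 2 * B) - 1))
  <= (1 + c * expR (L / 2) + 2 * expR 1 * c) / (1 + x).
Proof.
move=> c0 eta0 C0 K0.
have eta4 : 0 < eta / 4 by rewrite divr_gt0.
have [c' C' K'] : [/\ 0 <= c, 0 <= C & 0 <= K] by rewrite !ltW.
near=> x.
have x1 : 1 <= x by near: x; exact: nbhs_pinfty_ge.
have x0 : 0 < x by lra.
have H8 : (8 / K) * (1 + x) ^+ 1 <= expR (1 * x).
  by near: x; apply: poly_le_exp => //; rewrite divr_ge0.
have H1 : ((c + 2 + C / 4) * 4 / K) * (1 + x) ^+ 2 <= expR (eta / 4 * x).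
  near: x; apply: poly_le_exp => //; apply: divr_ge0 => //; apply: mulr_ge0 => //.
  by rewrite addr_ge0 ?addr_ge0 ?divr_ge0.
have H2 : (8 / K) * (1 + x) ^+ 2 <= expR (2^-1 * x).
  by near: x; apply: poly_le_exp => //; rewrite divr_ge0.
have H3 : (16 * C / K ^+ 2) * (1 + x) ^+ 4 <= expR (eta * x).
  by near: x; apply: poly_le_exp => //; apply: divr_ge0; rewrite ?mulr_ge0 ?exprn_ge0.
set t := 1 + x in H8 H1 H2 H3 *; have tE : t = 1 + x by [].
have t0 : 0 < t by lra.
split.
  rewrite mul1r expr1 in H8; rewrite mulrA ler_pdivlMr// -ler_pdivrMr//.
  by rewrite mulrAC.
move=> S D B a S0 Sc D0 DE BE aE; rewrite !(mulrDl _ _ t^-1) (mulrDr S) addrA.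
apply: lerD; first apply: lerD.
- have -> : a * (expR x * (K / t)) = K / 4 * expR (eta / 4 * x) ^+ 2 / t.
    rewrite aE -expRM_natl (_ : 2%:R * _ = (eta / 2 - 1) * x + x); last by field.
    by rewrite expRD; field; rewrite gt_eqF.
  have -> : 4 * a ^+ 2 * B = C / 4.
    rewrite aE BE exprMn -expRM_natl.
    have -> : expR ((2 - eta) * x) = (expR (2%:R * ((eta / 2 - 1) * x)))^-1.
      by rewrite -expRN; congr expR; field.
    by field; rewrite gt_eqF// expR_gt0.
  rewrite -expRD; apply: (false_positive_rate c' C' K0 tE x0 _ H1 S0 Sc D0 DE).
  by rewrite -[leLHS]expR0 ler_expR mulr_ge0// ltW.
- rewrite [x / 2]mulrC; exact: (linear_tail_rate _ c' K0 tE x0 H2 S0 Sc).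
- have -> : B = C * (expR x ^+ 2 / expR (eta * x)).
    by rewrite BE -expRM_natl -expRN -expRD; congr (_ * expR _); ring.
  by apply: (chi2_tail_rate c' C' K0 tE x1 _ _ H3 S0 Sc); exact: expR_gt0.
Unshelve. all: by end_near. Qed.
End asymptotics.

(** * Tuning parameters and consistency *)

Section consistency.
Context {R : realType}.

Lemma jacobi_theta0 : jacobi_theta 0 = 1 :> R.
Proof.
rewrite /jacobi_theta (_ : esum _ _ = 1%E)//.
rewrite -(@esum_set1 R int 0 (fun=> 1%E)) ?lee01//.
rewrite [RHS]esum_mkcond; apply: eq_esum => r _.
case: ifPn => [|r0]; first by rewrite inE => ->.
rewrite expr0n expn_eq0 andbT absz_eq0; case: eqVneq => // rE.
by move: r0; rewrite rE notin_setE => /(_ erefl).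
Qed.

Lemma l_jacobi0 (gamma : R) : l_jacobi gamma 0 = 0.
Proof. by rewrite /l_jacobi jacobi_theta0 ln1 ln0// mulr0 subrr. Qed.

(** Without a critical point [z_jacobi] defaults to 0, where [l_jacobi] is 0 because [h(0) = 1] and
    [ln 0 = 0]; a nonzero value thus certifies a genuine point of [(0, 1)]. *)
Lemma z_jacobi_in01 (gamma : R) : l_jacobi gamma (z_jacobi gamma) != 0 ->
  0 < z_jacobi gamma < 1.
Proof.
by rewrite /z_jacobi; case: xgetP => [z _ []//|_]; rewrite l_jacobi0 eqxx.
Qed.

Lemma limn_esup_lt_near (u : nat -> R) (r : R) : (forall n, 0 <= u n) ->
  (limn_esup (fun n => (u n)%:E) < r%:E)%E ->
  exists c, [/\ 0 < c, c < r & \forall n \near \oo, u n <= c].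
Proof.
move=> u0 /ereal_inf_lt[_ [V FV <-]] supr.
have [n Vn] : exists n, V n by exact: (filter_ex FV).
have ub k : V k -> ((u k)%:E <= ereal_sup [set (u n)%:E | n in V])%E.
  by move=> Vk; apply: ereal_sup_ubound; exists k.
have r0 : 0 < r.
  by rewrite -lte_fin; apply: le_lt_trans supr; apply: le_trans (ub n Vn); rewrite lee_fin.
case: (ereal_sup _) supr ub => [b| |] //; last by move=> _ /(_ n Vn).
rewrite lte_fin => br ub; exists (Num.max b (r / 2)); split.
- by rewrite lt_max divr_gt0// orbT.
- by rewrite gt_max br; lra.
- by apply: filterS FV => k /ub; rewrite lee_fin le_max => ->.
Qed.

Lemma ln_nat_cvg : ln n%:R @[n --> \oo] --> (+oo : set_system R).
Proof.
apply/cvgryPge => A.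
have /cvgryPge/(_ (expR A)) := @cvgr_idn R.
apply: filterS => n An; rewrite -[leLHS]expRK ler_ln// posrE ?expR_gt0//.
exact: lt_le_trans (expR_gt0 A) An.
Qed.

Lemma ln_nat_ge0 n : 0 <= ln n%:R :> R.
Proof. by case: n => [|n]; [rewrite ln0|rewrite ln_ge0// ler1n]. Qed.

(* The paper's [tau] is taken to be [(1 + ln n)^-1] (up to the factor [L / kappa]), and the
   threshold is half of the energy that the truncation at [tuning_m] must retain. *)
Definition tuning_m (n d s : nat) (kappa L : R) (l : nat) : R :=
  Num.sqrt (l%:R * (`|L| / kappa + (1 + ln n%:R)^-1)).

Definition tuning_lam (n d s : nat) (kappa L : R) (l : nat) : R :=
  kappa ^+ 2 / (2 * (`|L| + kappa)) / (1 + ln n%:R).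

(** The absolute value of [L] in the tuning makes positivity hold for every real [L]; in the
    consistency proof [L >= 0] and it disappears. *)
Lemma tuning_m_gt0 n d s (kappa L : R) l : 0 < kappa -> (0 < l)%N ->
  0 < tuning_m n d s kappa L l.
Proof.
move=> k0 l0; rewrite sqrtr_gt0 mulr_gt0 ?ltr0n// ltr_wpDl ?divr_ge0 ?(ltW k0)//.
by rewrite invr_gt0 ltr_wpDr// ln_nat_ge0.
Qed.

Lemma tuning_lam_gt0 n d s (kappa L : R) l : 0 < kappa -> 0 < tuning_lam n d s kappa L l.
Proof.
move=> k0; rewrite divr_gt0 ?ltr_wpDr ?ln_nat_ge0// divr_gt0 ?exprn_gt0//.
by rewrite mulr_gt0// ltr_wpDl.
Qed.

(** With [t = 1 + ln n], [signal_ge] leaves [kappa^2 / (L t + kappa) >= kappa^2 / ((L + kappa) t)],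
    and the right-hand side is exactly [2 lam]. *)
Lemma tuning_signal n d s' (kappa L : R) (s : nat) (f : d.-tuple R -> R) (J : {set 'I_d})
    (j : 'I_d) : 0 < kappa -> 0 <= L -> L2_cube f -> C1 kappa L s f J -> j \in J ->
  2 * tuning_lam n d s' kappa L #|J| <=
    \sum_(k \in S_freq j (tuning_m n d s' kappa L #|J|) J) theta f k ^+ 2.
Proof.
move=> k0 L0 f2 C1f jJ; have J0 : (0 < #|J|)%N by rewrite card_gt0; apply/set0Pn; exists j.
have := signal_ge f2 C1f jJ (tuning_m_gt0 n d s' L k0 J0).
set Sig := \sum_(k \in _) _; rewrite /tuning_m /tuning_lam ger0_norm//.
have x0 := ln_nat_ge0 n; set x := ln _ in x0 *.
have JR : 0 < #|J|%:R :> R by rewrite ltr0n.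
have t0 : 0 < 1 + x by lra.
have g0 : 0 < L / kappa + (1 + x)^-1 by rewrite ltr_wpDl ?invr_gt0// divr_ge0// ltW.
rewrite sqr_sqrtr; last by rewrite mulr_ge0// ltW.
have k1 : 0 < L * (1 + x) + kappa by rewrite ltr_wpDl// mulr_ge0// ltW.
have -> : (#|J|%:R * (L / kappa + (1 + x)^-1))^-1 * (#|J|%:R * L) =
    kappa - kappa ^+ 2 / (L * (1 + x) + kappa).
  by field; rewrite !gt_eqF//= ?gt_eqF//; lra.
rewrite -lerBlDr opprB addrC subrK => H; apply: le_trans H.
have -> : 2 * (kappa ^+ 2 / (2 * (L + kappa)) / (1 + x)) = kappa ^+ 2 / ((L + kappa) * (1 + x)).
  by field; rewrite !gt_eqF//; lra.
rewrite ler_pM2l ?exprn_gt0// lef_pV2 ?posrE//; last by rewrite mulr_gt0//; lra.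
by nra.
Qed.

(** [card_S_freq] gives the exponent [#|I| * (l - tau * ln z)] with [tau = 1 / (1 + ln n)]. As
    [#|I| <= c ln n] and [tau ln n <= 1], the [tau] part adds at most [- c ln z], a constant factor;
    this is why [tau] decreases like [1 / ln n]. *)
Lemma tuning_card n d s' (kappa L c z : R) (s : nat) (j : 'I_d) (I : {set 'I_d}) :
  0 < kappa -> 0 <= L -> 0 < z < 1 -> 0 <= c -> 0 <= l_jacobi (L / kappa) z ->
  s%:R <= c * ln n%:R -> (#|I| <= s)%N ->
  (size (finmap.enum_fset (fset_set (S_freq j (tuning_m n d s' kappa L #|I|) I))))%:R <=
  expR (- (c * ln z)) * expR (c * l_jacobi (L / kappa) z * ln n%:R).
Proof.
move=> k0 L0 z01 c0 l0 sc Is.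
have := card_S_freq z01 j (tuning_m n d s' kappa L #|I|) I.
have h1 := jacobi_theta_ge1 z01.
have lz : ln z < 0 by exact: ln_lt0.
rewrite /tuning_m ger0_norm//; have x0 := ln_nat_ge0 n; set x := ln n%:R in x0 sc *.
have t0 : 0 < 1 + x by lra.
have ti : (1 + x)^-1 * (1 + x) = 1 by rewrite mulVf// gt_eqF.
set tau := (1 + x)^-1 in ti *.
have tau0 : 0 < tau by rewrite invr_gt0.
rewrite sqr_sqrtr; last by rewrite mulr_ge0// addr_ge0 ?divr_ge0// ltW.
rewrite -ler_pdivlMr ?expR_gt0// => H; apply: le_trans H _.
rewrite -[jacobi_theta z]lnK ?posrE ?(lt_le_trans ltr01)// -expRM_natl -expRN -!expRD ler_expR.
set l := l_jacobi _ _ in l0 *.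
have -> : #|I|%:R * ln (jacobi_theta z) - #|I|%:R * (L / kappa + tau) * ln z =
    #|I|%:R * (l - tau * ln z) by rewrite /l /l_jacobi; ring.
have lt0 : 0 <= l - tau * ln z by nra.
apply: (@le_trans _ _ (c * x * (l - tau * ln z))).
  by apply: ler_wpM2r => //; apply: le_trans sc; rewrite ler_nat.
have xt : x * tau <= 1 by nra.
have : c * (x * tau) <= c by rewrite ler_piMr.
by nra.
Qed.
End consistency.

Theorem corollary3 (R : realType) :
  exists m lam : nat -> nat -> nat -> R -> R -> nat -> R,
    (forall (n d s : nat) (kappa L : R) (l : nat),
       (1 <= s <= d)%N -> (1 <= l <= s)%N -> 0 < kappa ->
       0 < m n d s kappa L l /\ 0 < lam n d s kappa L l) /\
    (forall (kappa L : R) (d s : nat -> nat),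
       0 < kappa ->
       (forall n, (1 <= s n <= d n)%N) ->
       d n @[n --> \oo] --> \oo ->
       s n @[n --> \oo] --> \oo ->
       (fun n => ln (ln (d n)%:R) : R^o) =o_\oo (fun n => ln n%:R : R^o) ->
       (limn_esup (fun n => ((s n)%:R / ln n%:R : R)%:E)
          < (2 / l_jacobi (L / kappa) (z_jacobi (L / kappa)))%:E)%E ->
       consistent kappa L s
         (fun n => @Jhat R n (d n) (s n)
                     (m n (d n) (s n) kappa L) (lam n (d n) (s n) kappa L))).
Proof.
exists (@tuning_m R), (@tuning_lam R); split.
  move=> n d s kappa L l _ /andP[l0 _] k0; split; first exact: tuning_m_gt0.
  exact: tuning_lam_gt0.
move=> kappa L d s k0 sd dy sy llo lsup disp Omega P f J Y H.
(* The sum in [C1] is nonnegative, hence so is its bound [L]; [sd] provides a coordinate at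
   [n = 1]. *)
have L0 : 0 <= L.
  have [_ [fL _ _ _] _] := H 1%N isT.
  have d0 : (0 < d 1)%N by have /andP[s1 sd1] := sd 1%N; exact: leq_trans s1 sd1.
  rewrite -lee_fin; apply: le_trans (fL (Ordinal d0)).
  by apply: esum_ge0 => k _; rewrite lee_fin mulr_ge0 ?sqr_ge0.
have [c [c0 cl scn]] := limn_esup_lt_near
  (fun n => divr_ge0 (ler0n _ (s n)) (ln_nat_ge0 n)) lsup.
set l := l_jacobi _ _ in cl.
(* Division by 0 gives 0, so [0 < c < 2 / l] excludes [l <= 0], and with it the default value of
   [z_jacobi]. *)
have l0 : 0 < l.
  by move: (lt_trans c0 cl); rewrite pmulr_rgt0// invr_gt0.
have z01 : 0 < z_jacobi (L / kappa) < 1.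
  by apply: z_jacobi_in01; rewrite gt_eqF.
have cl2 : c * l < 2 by rewrite -ltr_pdivlMr.
pose eta := 2 - c * l; have eta0 : 0 < eta by rewrite subr_gt0.
have cl0 : 0 < c * l by exact: mulr_gt0.
pose C := expR (- (c * ln (z_jacobi (L / kappa)))).
pose K := kappa ^+ 2 / (2 * (`|L| + kappa)).
have K0 : 0 < K by rewrite divr_gt0 ?exprn_gt0// mulr_gt0// ltr_wpDl.
pose G := 1 + c * expR (L / 2) + 2 * expR 1 * c.
have rate := ln_nat_cvg (error_rate L c0 eta0 (expR_gt0 _ : 0 < C) K0).
have lnd : \forall n \near \oo, `|ln (ln (d n)%:R) : R| <= eta / 4 * `|ln n%:R : R|.
  by move/eqoP : llo => /(_ (eta / 4)); apply; rewrite divr_gt0.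
have bound : \forall n \near \oo, (P n [set w | Jhat n (s n) (tuning_m n (d n) (s n) kappa L)
    (tuning_lam n (d n) (s n) kappa L) (fun phi => Y n phi w) <> J n] <=
    (G / (1 + ln n%:R))%:E)%E.
  case: rate scn lnd => [N1 _ r1] [N2 _ r2] [N3 _ r3].
  (* The 2 ensures [ln n > 0], so that [s / ln n <= c] can be multiplied out. *)
  exists (maxn 2 (maxn N1 (maxn N2 N3))) => // n /=.
  rewrite !geq_max => /and4P[n1 /r1/=[n8 rt] /r2/= scn /r3/= lnd].
  have n0 : (0 < n)%N by exact: ltnW.
  have [f2 C1f wn] := H n n0.
  have x0 := @ln_nat_ge0 R n.
  have nE : n%:R = expR (ln n%:R) :> R by rewrite lnK// posrE ltr0n.
  rewrite -nE in n8 rt.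
  have x1 : 0 < ln n%:R :> R.
    by rewrite ln_gt0// ltr1n.
  have sc : (s n)%:R <= c * ln n%:R.
    by rewrite -ler_pdivrMr.
  have d0 : (0 < d n)%N by have /andP[s1 sd1] := sd n; exact: leq_trans s1 sd1.
  have dE : (d n)%:R = expR (ln (d n)%:R) :> R by rewrite lnK// posrE ltr0n.
  have D0 := @ln_nat_ge0 R (d n).
  have D1 : ln (d n)%:R <= expR (eta / 4 * ln n%:R).
    move: D0; rewrite le_eqVlt => /orP[/eqP <-|D0]; first exact: expR_ge0.
    rewrite -[leLHS]lnK ?posrE// ler_expR -[ln n%:R]ger0_norm//.
    exact: le_trans (ler_norm _) lnd.
  pose a : R := expR ((eta / 2 - 1) * ln n%:R) / 4.
  pose B := C * expR ((2 - eta) * ln n%:R).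
  have a0 : 0 <= a by rewrite divr_ge0// expR_ge0.
  have a4 : a <= 1 / 4.
    rewrite ler_pM2r ?invr_gt0// -[leRHS]expR0 ler_expR mulr_le0_ge0//.
    by rewrite /eta; lra.
  have B0 : 0 <= B by rewrite mulr_ge0 ?expR_ge0.
  have lamE : tuning_lam n (d n) (s n) kappa L = fun=> K / (1 + ln n%:R) by [].
  have lam0 : 0 < K / (1 + ln n%:R).
    exact: (@tuning_lam_gt0 R n (d n) (s n) kappa L 0).
  rewrite lamE; apply: le_trans (Jhat_error_bound n0 f2 C1f wn lam0 B0 _ a0 a4 _ _) _.
  - move=> j I /andP[_ Is]; apply: le_trans (tuning_card _ _ k0 L0 z01 (ltW c0) (ltW l0) sc Is) _.
    rewrite ler_pM2l ?expR_gt0// ler_expR ler_pM2r//.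
    by rewrite /eta opprB addrC subrK.
  - exact: n8.
  - by move=> j jJ; have := tuning_signal n (s n) k0 L0 f2 C1f jJ.
  rewrite lee_fin; apply: le_trans (rt (s n)%:R (ln (d n)%:R) B a _ sc D0 D1 erefl erefl) => //.
  have -> : Num.sqrt n%:R = expR (ln n%:R / 2) :> R.
    rewrite -[RHS]ger0_norm ?expR_ge0// -sqrtr_sqr -expRM_natl [in LHS]nE.
    by congr (Num.sqrt (expR _)); field.
  by rewrite natr1 expRM_natl -dE.
apply: (@squeeze_cvge _ _ _ _ (cst 0%E) _ (fun n => (G / (1 + ln n%:R))%:E)).
- by apply: filterS bound => n ->; rewrite andbT measure_ge0.
- exact: cvg_cst.
apply: cvg_EFin; first by near=> n.
rewrite -[X in _ --> X](mulr0 G); apply: cvgMr.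
apply/gtr0_cvgV0; first by near=> n; rewrite ltr_wpDr// ln_nat_ge0.
apply/cvgryPge => A; have /cvgryPge/(_ A) := @ln_nat_cvg R.
by apply: filterS => n An; rewrite (le_trans An)// lerDr.
Unshelve. all: by end_near. Qed.
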